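(* Let $r\geqslant3$ and let $\mathcal A_2$ be the class of $r$th order linear ODEs in the second Arnold form $$x^{(r)}+a_{r-1}(t)x^{(r-1)}+\dots+a_2(t)x^{(2)}=b(t)$$ with arbitrary smooth functions $a_{r-1},\dots,a_2,b$ of $t$. The equivalence groupoid of $\mathcal A_2$ is constituted by the admissible transformations whose equations-sources exhaust the whole class $\mathcal A_2$ and whose transformational parts are of the form $$\tilde t=\frac{\psi_2(t)}{\psi_1(t)},\quad \tilde x=\frac{x}{\psi_1(t)}+X_0(t),$$ where $\psi_1=\psi_1(t)$ and $\psi_2=\psi_2(t)$ are arbitrary linearly independent solutions of the homogeneous equation associated with the corresponding equation-source, and $X_0$ is an arbitrary smooth function of $t$.
   Context: The underlying field $\mathbb F$ is $\mathbb R$ or $\mathbb C$; all variables, functions and constants are real or complex, respectively. $x=x(t)$ is the unknown function, $x^{(k)}=d^kx/dt^k$. Everything is local: functions and transformations are smooth and considered on suitable open domains (in particular, $\psi_1$ and the derivative of $\psi_2/\psi_1$ are nonvanishing on the domain considered). A point transformation is a transformation $\tilde t=T(t,x)$, $\tilde x=X(t,x)$ with nonvanishing Jacobian $\partial(T,X)/\partial(t,x)$; it acts on ODEs via prolongation to derivatives. An admissible transformation of a class of ODEs is a triple $(\mathcal E,\tilde{\mathcal E},\mathcal T)$, where $\mathcal E$ (the equation-source) and $\tilde{\mathcal E}$ (the equation-target) are equations of the class and $\mathcal T$ (the transformational part) is a point transformation mapping $\mathcal E$ to $\tilde{\mathcal E}$. The equivalence groupoid of the class is the set of all its admissible transformations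 with composition. The homogeneous equation associated with a linear ODE is obtained by replacing its right-hand side $b$ by $0$. *)

(* Defs.v *)
From HB Require Import structures.
From mathcomp Require Import all_boot all_order all_algebra.
From mathcomp Require Import complex.
From mathcomp Require Import all_classical all_reals all_analysis.

Set Implicit Arguments.
Unset Strict Implicit.
Unset Printing Implicit Defensive.

Import Order.TTheory GRing.Theory Num.Theory.
Import numFieldNormedType.Exports.

Local Open Scope classical_set_scope.
Local Open Scope ring_scope.

(* The ground field is R or C = R[i]; both are numFieldType's, so derivatives
   below are real derivatives in the first case and complex (holomorphic)
   derivatives in the second. *)
Variant real_or_complex : numFieldType -> Prop :=
| Is_real (R : realType) : real_or_complex R
| Is_complex (R : realType) : real_or_complex (complex R).

Section Smoothness.
Variables (F : numFieldType) (V : normedModType F).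

Fixpoint class_C (n : nat) (U : set V) (f : V -> F) : Prop :=
  match n with
  | 0 => forall p, U p -> {for p, continuous f}
  | m.+1 => (forall p, U p -> differentiable f p) /\
            (forall v : V, class_C m U ('D_v f))
  end.

Definition smooth_on (U : set V) (f : V -> F) : Prop :=
  forall n, class_C n U f.

End Smoothness.

Section JetSpace.
Variables (F : numFieldType) (r : nat).

(* The jet space J^r of functions of one variable: the coordinates of
   z : 'rV_r.+2 are (t, x, x', ..., x^(r)), the jet variable x^(k), k <= r,
   having index k.+1. *)
Definition jet_t (z : 'rV[F]_r.+2) : F := z 0 ord0.
Definition jet_x (k : nat) (z : 'rV[F]_r.+2) : F := z 0 (inord k.+1).
Definition jet_base (z : 'rV[F]_r.+2) : F * F := (jet_t z, jet_x 0 z).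

Definition jet (f : F -> F) (t : F) : 'rV[F]_r.+2 :=
  \row_(i < r.+2) if (i : nat) is k.+1 then derive1n k f t else t.

(* D_t = d/dt + sum_k x^(k+1) d/dx^(k), truncated to J^r; this is the usual
   total derivative on differential functions of order less than r. *)
Definition total_derive (G : 'rV[F]_r.+2 -> F) (z : 'rV[F]_r.+2) : F :=
  'D_(delta_mx 0 ord0) G z +
  \sum_(k < r) jet_x k.+1 z * 'D_(delta_mx 0 (inord k.+1)) G z.

End JetSpace.

Section PointTransformations.
Variable F : numFieldType.

(* Only the values of trans_T and trans_X on the domain are relevant. *)
Record transformation := Transformation {
  trans_dom : set (F * F);
  trans_T : F * F -> F;
  trans_X : F * F -> F }.

Definition restrict_trans (phi : transformation) (W : set (F * F)) :=
  Transformation W (trans_T phi) (trans_X phi).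

Definition jacobian_TX (phi : transformation) (p : F * F) : F :=
  'D_(1, 0) (trans_T phi) p * 'D_(0, 1) (trans_X phi) p -
  'D_(0, 1) (trans_T phi) p * 'D_(1, 0) (trans_X phi) p.

Definition point_transformation (phi : transformation) : Prop :=
  [/\ open (trans_dom phi), trans_dom phi !=set0,
      smooth_on (trans_dom phi) (trans_T phi),
      smooth_on (trans_dom phi) (trans_X phi) &
      forall p, trans_dom phi p -> jacobian_TX phi p != 0].

Variable r : nat.

(* Prolongation to derivatives:
   xt^(0) = X(t, x), xt^(k+1) = (D_t xt^(k)) / (D_t T),
   meaningful at the jets where D_t T != 0. *)
Definition DtT (phi : transformation) : 'rV[F]_r.+2 -> F :=
  total_derive (fun z => trans_T phi (jet_base z)).

Fixpoint prolong_x (phi : transformation) (k : nat) : 'rV[F]_r.+2 -> F :=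
  match k with
  | 0 => fun z => trans_X phi (jet_base z)
  | m.+1 => fun z => total_derive (prolong_x phi m) z / DtT phi z
  end.

Definition prolong (phi : transformation) (z : 'rV[F]_r.+2) : 'rV[F]_r.+2 :=
  \row_(i < r.+2)
    if (i : nat) is k.+1 then prolong_x phi k z else trans_T phi (jet_base z).

End PointTransformations.

Section SecondArnoldForm.
Variables (F : numFieldType) (r : nat).

(* x^(r) + a_(r-1)(t) x^(r-1) + ... + a_2(t) x^(2) = b(t) for t in ode_dom;
   only ode_coef i with 2 <= i < r is used. *)
Record arnold2_ode := Arnold2Ode {
  ode_dom : set F;
  ode_coef : nat -> F -> F;
  ode_rhs : F -> F }.

Definition class_A2 (E : arnold2_ode) : Prop :=
  [/\ open (ode_dom E), ode_dom E !=set0,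
      (forall i, (2 <= i < r)%N -> smooth_on (ode_dom E) (ode_coef E i)) &
      smooth_on (ode_dom E) (ode_rhs E)].

(* The submanifold of J^r defined by the equation. *)
Definition ode_locus (E : arnold2_ode) : set 'rV[F]_r.+2 :=
  [set z | ode_dom E (jet_t z) /\
    jet_x r z + \sum_(2 <= i < r) ode_coef E i (jet_t z) * jet_x i z
      = ode_rhs E (jet_t z)].

Definition homogeneous (E : arnold2_ode) : arnold2_ode :=
  Arnold2Ode (ode_dom E) (ode_coef E) (fun=> 0).

Definition solution_on (E : arnold2_ode) (U : set F) (f : F -> F) : Prop :=
  smooth_on U f /\ forall t, U t -> ode_locus E (jet r f t).

Definition lin_indep_on (U : set F) (f g : F -> F) : Prop :=
  forall c d : F, (forall t, U t -> c * f t + d * g t = 0) -> c = 0 /\ d = 0.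

(* phi maps E to E': over the domain of phi, the prolongation of phi
   identifies the locus of E with the locus of E'. *)
Definition maps_ode (phi : transformation F) (E E' : arnold2_ode) : Prop :=
  (forall p, trans_dom phi p ->
     ode_dom E p.1 /\ ode_dom E' (trans_T phi p)) /\
  (forall z : 'rV[F]_r.+2, trans_dom phi (jet_base z) -> DtT phi z != 0 ->
     ode_locus E z <-> ode_locus E' (prolong phi z)).

Definition equivalence_groupoid :
    set (arnold2_ode * arnold2_ode * transformation F) :=
  [set m | [/\ class_A2 m.1.1, class_A2 m.1.2, point_transformation m.2 &
               maps_ode m.2 m.1.1 m.1.2]].

(* T = psi2/psi1, X = x/psi1 + X0, where psi1, psi2, X0 are functions on the
   projection of the domain of phi to the t-axis. *)
Definition A2_form (E : arnold2_ode) (phi : transformation F) : Prop :=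
  let U := [set p.1 | p in trans_dom phi] in
  [/\ open (trans_dom phi), trans_dom phi !=set0, U `<=` ode_dom E &
  exists psi1 psi2 X0 : F -> F,
    [/\ solution_on (homogeneous E) U psi1 /\
          solution_on (homogeneous E) U psi2,
        lin_indep_on U psi1 psi2,
        (forall t, U t ->
           psi1 t != 0 /\ derive1 (fun s => psi2 s / psi1 s) t != 0),
        smooth_on U X0 &
        forall p, trans_dom phi p ->
          trans_T phi p = psi2 p.1 / psi1 p.1 /\
          trans_X phi p = p.2 / psi1 p.1 + X0 p.1]].

End SecondArnoldForm.

(* Main.v *)
(* Let xt^(k) be the prolonged variables and P = D_t T.  By induction on k,
   xt^(k) = Q_k x^(k) + (rho_k x^(m+1) + S_k) x^(k-1) + (terms of order <= k-2),
   with m = 1, Q_k = J / P^(k+1) and rho_k a negative multiple of J T_x / P^(k+2),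
   J being the Jacobian.  On the locus of a linear source equation the
   coefficient of x^(m+1) x^(r-1) in a linear target equation must vanish, so
   T_x = 0.  The same argument with m = 0 then gives X_xx = 0.

   Locally T = tau(t) and X = X1(t) x + X0(t).  A target equation in the second
   Arnold form is unchanged by xt |-> xt + c and xt |-> xt + c tt, so the source
   is unchanged by adding multiples of 1/X1 and tau/X1, which are therefore
   solutions psi1, psi2 of its homogeneous equation.

   Conversely, with xt^(k) = sum_j A_kj(t) x^(j) + ..., the source operator can
   be expanded as sum_k m_k xt^(k) by solving a triangular system; evaluating at
   psi1 and psi2 gives m_0 = m_1 = 0.  The coefficients of the target are
   m_k / m_r composed with a local inverse of psi2/psi1, whose existence over R
   and C alike follows from the contraction argument below. *)

(* The lower-order terms of xt^(r) are never computed: they are only known to have bounded order,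
   and comparing the equation at jets that differ in two or three coordinates eliminates them. Nor
   are the exact values of rho_k needed: two positive integers weigh the contributions of the
   leading coefficient and of P, and these either add up with the same sign (m = 1) or one of them
   vanishes (m = 0). The case m = 1 must come first because P = D_t T has order 1 in general. Only
   after T_x = 0 does P have order 0, which lets the same recursion start from xt^(0). The terms in
   question appear from order m + 2 on, and for m = 1 this is where r >= 3 enters. Both directions
   require shrinking the domain, for different reasons. T_x = 0 makes T only locally constant in x,
   so psi1, psi2 and X0 are found over balls. Conversely, psi2/psi1 need not be injective, and the
   target coefficients are functions of tt only where it is. *)
Require Import Defs.
From mathcomp Require Import all_boot all_order all_algebra.
From mathcomp Require Import complex all_classical all_reals all_analysis.
From mathcomp Require Import ring lra zify.
Import Order.TTheory GRing.Theory Num.Theory.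
Import numFieldNormedType.Exports.
Set Implicit Arguments.
Unset Strict Implicit.
Unset Printing Implicit Defensive.
Local Open Scope classical_set_scope.
Local Open Scope ring_scope.

(** * Directional derivatives and smooth functions *)

(* A directional derivative only sees the restriction to a line; this replaces
   the chain rule for affine substitutions and needs no differentiability. *)
Lemma derive_line (F : numFieldType) (V W X : normedModType F)
    (f : V -> X) (g : W -> X) a b v w :
  (\forall h \near nbhs (0 : F), f (h *: v + a) = g (h *: w + b)) ->
  'D_v f a = 'D_w g b.
Proof.
move=> fg; rewrite /derive.
have fg0 : f a = g b by have := nbhs_singleton fg; rewrite !scale0r !add0r.
have := nbhs_dnbhs fg => {}fg.
congr (lim _); rewrite eqEsubset; split; apply: near_eq_cvg; near=> h => /=;
  by rewrite fg0 (near fg h).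
Unshelve. all: by end_near. Qed.

Lemma near_eq_differentiable (F : numFieldType) (V W : normedModType F)
    (f g : V -> W) a :
  {near a, f =1 g} -> differentiable f a -> differentiable g a.
Proof.
move=> fg df; have fga : f a = g a := nbhs_singleton fg.
suff H : g \o shift a = cst (g a) + 'd f a +o_ 0 id.
  have E : 'd g a = 'd f a :> (V -> W).
    by apply: diff_unique H; exact: diff_continuous.
  by apply/diff_locallyP; rewrite E; split => //; exact: diff_continuous.
have /diff_locallyP[_ /eqaddoP fo] := df.
apply/eqaddoP => e e0; have := fo e e0.
have fg' : \forall h \near nbhs (0 : V), f (h + a) = g (h + a).
    by have := fg; rewrite (near_shift 0) subr0; apply: filterS => h.
apply: filterS2 fg' => h fgh.
by rewrite /= !fctE /= fgh fga.
Qed.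

Section ClassC.
Variables (F : numFieldType) (V : normedModType F).
Implicit Types (f g : V -> F) (U : set V).

Lemma class_CW n U f : class_C n.+1 U f -> class_C n U f.
Proof.
elim: n f => [|n IH] f [df Df].
  by move=> p Up; apply: differentiable_continuous; exact: df.
by split => // v; apply: IH; exact: Df.
Qed.

Lemma class_C_sub n U U' f : U' `<=` U -> class_C n U f -> class_C n U' f.
Proof.
elim: n f => [|n IH] f UU /=; first by move=> cf p /UU; exact: cf.
by move=> [df Df]; split=> [p /UU /df //|v]; exact: IH.
Qed.

Lemma class_C_ext n U f g : open U -> (forall p, U p -> f p = g p) ->
  class_C n U f -> class_C n U g.
Proof.
move=> oU; elim: n f g => [|n IH] f g fg /=.
  move=> cf p Up; rewrite /prop_for /continuous_at -fg //.
  have /near_eq_cvg H : {near nbhs p, f =1 g}.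
    by near=> q; rewrite fg //; near: q; exact: open_nbhs_nbhs.
  by move=> t /(cf p Up) /H.
move=> [df Df]; have fgn p : U p -> {near p, f =1 g}.
  by move=> Up; near=> q; rewrite fg //; near: q; exact: open_nbhs_nbhs.
split=> [p Up|v]; first exact: near_eq_differentiable (fgn p Up) (df p Up).
by apply: (IH ('D_v f)) => // p Up; exact: near_eq_derive (fgn p Up).
Unshelve. all: by end_near. Qed.

Lemma class_C_cst n U (c : F) : class_C n U (fun=> c).
Proof.
elim: n c => [|n IH] c /=; first by move=> p _; exact: cst_continuous.
split=> [p _|v]; first exact: differentiable_cst.
have -> : 'D_v (fun=> c) = fun=> 0; last exact: IH.
by apply/funext => p; exact: derive_cst.
Qed.

Lemma class_C_aff n U f (l : V -> F) : (forall p, differentiable f p) ->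
  (forall v p, 'D_v f p = l v) -> class_C n U f.
Proof.
move=> df Df; case: n => [|n] /=.
  by move=> p _; exact: differentiable_continuous.
split=> [//|v]; rewrite (_ : 'D_v f = fun=> l v); first exact: class_C_cst.
exact/funext.
Qed.

Lemma class_CD n U f g : open U -> class_C n U f -> class_C n U g ->
  class_C n U (fun x => f x + g x).
Proof.
move=> oU; elim: n f g => [|n IH] f g /=.
  by move=> cf cg p Up; exact: (cvgD (cf p Up) (cg p Up)).
move=> [df Df] [dg Dg]; split=> [p Up|v].
  exact: (differentiableD (df p Up) (dg p Up)).
apply: (@class_C_ext _ _ (fun x => 'D_v f x + 'D_v g x)) => //.
  move=> p Up; rewrite -[fun x => f x + g x]/(f + g) deriveD //;
  by apply: diff_derivable; first [exact: df|exact: dg].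
exact: IH.
Qed.

Lemma class_CM n U f g : open U -> class_C n U f -> class_C n U g ->
  class_C n U (fun x => f x * g x).
Proof.
move=> oU; elim: n f g => [|n IH] f g.
  by move=> cf cg p Up; exact: (cvgM (cf p Up) (cg p Up)).
move=> Cf Cg; have [df Df] := Cf; have [dg Dg] := Cg; split=> [p Up|v].
  exact: (differentiableM (df p Up) (dg p Up)).
apply: (@class_C_ext _ _ (fun x => f x * 'D_v g x + g x * 'D_v f x)) => //.
  move=> p Up; have Hf := @diff_derivable _ _ _ _ _ v (df p Up).
  have Hg := @diff_derivable _ _ _ _ _ v (dg p Up).
  by rewrite (deriveM Hf Hg).
have [Wf Wg] := (class_CW Cf, class_CW Cg).
exact: class_CD oU (IH _ _ Wf (Dg v)) (IH _ _ Wg (Df v)).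
Qed.

Lemma class_CV n U f : open U -> (forall p, U p -> f p != 0) ->
  class_C n U f -> class_C n U (fun x => (f x)^-1).
Proof.
move=> oU f0; elim: n => [|n IH].
  by move=> cf p Up; exact: (cvgV (f0 p Up) (cf p Up)).
move=> Cf; have := Cf => -[df Df]; split=> [p Up|v].
  by apply: differentiableV; [exact: df|exact: f0].
have CV := IH (class_CW Cf).
apply: (@class_C_ext _ _
  (fun x => (-1) * ((f x)^-1 * (f x)^-1) * 'D_v f x)) => //.
  move=> p Up; rewrite deriveV ?f0 //; last by apply: diff_derivable; exact: df.
  by rewrite mulN1r -invrM ?unitfE ?f0// -exprVn exprVn expr2.
exact: class_CM oU (class_CM oU (class_C_cst _ _ _) (class_CM oU CV CV)) (Df v).
Qed.

(** [A] is affine with linear part [L], so it maps lines to lines and D_v (f o A) = (D_(L v) f) o A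
    holds at every point. The induction therefore stays within such compositions and does not need
    [U] open. *)
Lemma class_C_affcomp n (W : normedModType F) (A L : W -> V) U f :
  (forall w, differentiable A w) ->
  (forall w v (h : F), A (h *: v + w) = h *: L v + A w) ->
  class_C n U f -> class_C n (A @^-1` U) (f \o A).
Proof.
move=> dA AL; elim: n f => [|n IH] f /=.
  move=> cf p Up; apply: continuous_comp; last exact: cf.
  exact: differentiable_continuous.
move=> [df Df]; split=> [p Up|v].
  by apply: differentiable_comp => //; exact: df.
have -> : 'D_v (f \o A) = 'D_(L v) f \o A; last exact: IH.
apply/funext => w; apply: derive_line; apply: nearW => h.
by rewrite /= AL.
Qed.

End ClassC.

Section Smooth.
Variables (F : numFieldType) (V : normedModType F).
Implicit Types (f g : V -> F) (U : set V).

Lemma smooth_on_differentiable U f p : smooth_on U f -> U p -> differentiable f p.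
Proof. by move=> /(_ 1%N)[df _] /df. Qed.

Lemma smooth_on_derivable U f p v : smooth_on U f -> U p -> derivable f p v.
Proof.
by move=> sf Up; apply: diff_derivable; exact: smooth_on_differentiable sf Up.
Qed.

Lemma smooth_on_continuous U f p : smooth_on U f -> U p -> {for p, continuous f}.
Proof. by move=> sf Up; exact: (sf 0%N p Up). Qed.

Lemma smooth_on_sub U U' f : U' `<=` U -> smooth_on U f -> smooth_on U' f.
Proof. by move=> UU sf n; exact: class_C_sub (sf n). Qed.

Lemma smooth_on_ext U f g : open U -> (forall p, U p -> f p = g p) ->
  smooth_on U f -> smooth_on U g.
Proof. by move=> oU fg sf n; exact: class_C_ext (sf n). Qed.

Lemma smooth_on_derive U f v : smooth_on U f -> smooth_on U ('D_v f).
Proof. by move=> sf n; exact: (sf n.+1).2 v. Qed.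

Lemma smooth_on_cst U (c : F) : smooth_on U (fun=> c).
Proof. by move=> n; exact: class_C_cst. Qed.

Lemma smooth_onD U f g : open U -> smooth_on U f -> smooth_on U g ->
  smooth_on U (fun x => f x + g x).
Proof. by move=> oU sf sg n; exact: class_CD. Qed.

Lemma smooth_onM U f g : open U -> smooth_on U f -> smooth_on U g ->
  smooth_on U (fun x => f x * g x).
Proof. by move=> oU sf sg n; exact: class_CM. Qed.

Lemma smooth_onN U f : open U -> smooth_on U f -> smooth_on U (fun x => - f x).
Proof.
move=> oU sf; apply: (@smooth_on_ext _ (fun x => (-1) * f x)) => //.
  by move=> p _; rewrite mulN1r.
by apply: smooth_onM => //; exact: smooth_on_cst.
Qed.

Lemma smooth_onB U f g : open U -> smooth_on U f -> smooth_on U g ->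
  smooth_on U (fun x => f x - g x).
Proof. by move=> oU sf sg; apply: smooth_onD => //; exact: smooth_onN. Qed.

Lemma smooth_onV U f : open U -> (forall p, U p -> f p != 0) ->
  smooth_on U f -> smooth_on U (fun x => (f x)^-1).
Proof. by move=> oU f0 sf n; exact: class_CV. Qed.

Lemma smooth_on_div U f g : open U -> (forall p, U p -> g p != 0) ->
  smooth_on U f -> smooth_on U g -> smooth_on U (fun x => f x / g x).
Proof. by move=> oU g0 sf sg; apply: smooth_onM => //; exact: smooth_onV. Qed.

Lemma smooth_on_exp U f k : open U -> smooth_on U f ->
  smooth_on U (fun x => f x ^+ k).
Proof.
move=> oU sf; elim: k => [|k IH].
  by apply: smooth_on_ext oU _ (smooth_on_cst U 1) => p; rewrite expr0.
by apply: smooth_on_ext oU _ (smooth_onM oU sf IH) => p; rewrite exprS.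
Qed.

Lemma smooth_on_sum (I : Type) (s : seq I) (P : pred I) (G : I -> V -> F) U :
  open U -> (forall i, P i -> smooth_on U (G i)) ->
  smooth_on U (fun x => \sum_(i <- s | P i) G i x).
Proof.
move=> oU sG; elim: s => [|a s IH].
  by apply: smooth_on_ext oU _ (smooth_on_cst U 0) => p; rewrite big_nil.
case Pa : (P a).
  by apply: smooth_on_ext oU _ (smooth_onD oU (sG a Pa) IH) => p; rewrite big_cons Pa.
by apply: smooth_on_ext oU _ IH => p; rewrite big_cons Pa.
Qed.

Lemma deriveD_on U f g p v : smooth_on U f -> smooth_on U g -> U p ->
  'D_v (fun w => f w + g w) p = 'D_v f p + 'D_v g p.
Proof.
move=> sf sg Up.
exact: (deriveD (smooth_on_derivable sf Up) (smooth_on_derivable sg Up)).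
Qed.

Lemma deriveM_on U f g p v : smooth_on U f -> smooth_on U g -> U p ->
  'D_v (fun w => f w * g w) p = f p * 'D_v g p + g p * 'D_v f p.
Proof.
move=> sf sg Up.
exact: (deriveM (smooth_on_derivable sf Up) (smooth_on_derivable sg Up)).
Qed.

Lemma derive_sum_on U n (f : nat -> V -> F) p v : open U ->
  (forall i, (i < n)%N -> smooth_on U (f i)) -> U p ->
  'D_v (fun w => \sum_(i < n) f i w) p = \sum_(i < n) 'D_v (f i) p.
Proof.
move=> oU + Up; elim: n => [|n IH] sf.
  rewrite big_ord0 (_ : (fun w => _) = cst 0) ?derive_cst //.
  by apply/funext => w; rewrite big_ord0.
have sf' i : (i < n)%N -> smooth_on U (f i) by move=> /leqW; exact: sf.
rewrite big_ord_recr /= -IH // -(@deriveD_on U) //; last exact: sf.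
  by congr ('D_v _ p); apply/funext => w; rewrite big_ord_recr.
by apply: smooth_on_sum => // i _; exact: sf'.
Qed.

Lemma smooth_on_affcomp (W : normedModType F) (A L : W -> V) U (U' : set W) f :
  (forall w, differentiable A w) ->
  (forall w v (h : F), A (h *: v + w) = h *: L v + A w) ->
  (forall w, U' w -> U (A w)) ->
  smooth_on U f -> smooth_on U' (f \o A).
Proof.
move=> dA AL AU sf n.
by apply: class_C_sub (class_C_affcomp dA AL (sf n)) => w /AU.
Qed.

End Smooth.

Section OneVariable.
Variable F : numFieldType.
Implicit Types (f g : F -> F) (U : set F).

Lemma derive_scale f v t : derivable f t 1 -> 'D_v f t = v * derive1 f t.
Proof.
move=> /derivable1_diffP df; rewrite derive1E !deriveE //.
by rewrite -[v in LHS]mulr1 linearZ.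
Qed.

Lemma smooth_on_derive1 U f : smooth_on U f -> smooth_on U (derive1 f).
Proof.
move=> sf; have -> : derive1 f = 'D_1 f by apply/funext => t; rewrite derive1E.
exact: smooth_on_derive.
Qed.

Lemma smooth_on_derive1n U f k : smooth_on U f -> smooth_on U (derive1n k f).
Proof. by move=> sf; elim: k => [//|k IH]; exact: smooth_on_derive1. Qed.

Lemma derive_comp1 (V : normedModType F) (g : V -> F) f p v :
  differentiable g p -> differentiable f (g p) ->
  'D_v (f \o g) p = derive1 f (g p) * 'D_v g p.
Proof.
move=> dg df; rewrite deriveE; last exact: differentiable_comp.
rewrite diff_comp //= -!deriveE // derive_scale; last exact/derivable1_diffP.
by rewrite mulrC.
Qed.

(** The induction varies [f] and keeps [g]: differentiating replaces [f] by [derive1 f], which is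
    again smooth, while [g] loses one order. *)
Lemma class_C_comp n (V : normedModType F) (g : V -> F) f (U : set V) U' :
  open U -> (forall p, U p -> U' (g p)) -> smooth_on U' f -> class_C n U g ->
  class_C n U (f \o g).
Proof.
move=> oU UU'; elim: n f => [|n IH] f sf.
  move=> cg p Up; apply: continuous_comp; first exact: cg.
  by apply: smooth_on_continuous sf _; exact: UU'.
move=> Cg; have := Cg => -[dg Dg].
have df p : U p -> differentiable f (g p).
  by move=> Up; apply: smooth_on_differentiable sf _; exact: UU'.
split=> [p Up|v]; first by apply: differentiable_comp; [exact: dg|exact: df].
apply: (@class_C_ext _ _ _ _ (fun x => (derive1 f \o g) x * 'D_v g x)) => //.
  by move=> p Up; rewrite derive_comp1 //; [exact: dg|exact: df].
apply: (class_CM oU _ (Dg v)).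
by apply: IH; [exact: smooth_on_derive1 | exact: class_CW].
Qed.

Lemma smooth_on_comp (V : normedModType F) (g : V -> F) f (U : set V) U' :
  open U -> (forall p, U p -> U' (g p)) -> smooth_on U' f -> smooth_on U g ->
  smooth_on U (f \o g).
Proof. by move=> oU UU' sf sg n; exact: (class_C_comp oU UU' sf (sg n)). Qed.

Lemma near_eq_derive1 f g U t : open U -> (forall s, U s -> f s = g s) -> U t ->
  derive1 f t = derive1 g t.
Proof.
move=> oU fg Ut; rewrite !derive1E; apply: near_eq_derive.
by near=> q; rewrite fg //; near: q; exact: open_nbhs_nbhs.
Unshelve. all: by end_near. Qed.

End OneVariable.

(** * Mean value inequality and convergence over R and C *)

(** Models the real and imaginary parts, with [c] the embedding of R. Such a functional turns
    F-valued data into real data, to which the mean value theorem and the completeness of R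
    apply. *)
Record real_functional (F : numFieldType) (R : realType) (c : R -> F)
    (phi : F -> R) : Prop := RealFunctional {
  rfB : forall x y, phi (x - y) = phi x - phi y;
  rfM : forall r x, phi (c r * x) = r * phi x;
  rf_le : forall x, c `|phi x| <= `|x| }.

(* For F = R take im = 0 and i = 0, so that both ground fields are covered. *)
Record real_coordinates (F : numFieldType) (R : realType) (c : R -> F)
    (re im : F -> R) (i : F) : Prop := RealCoordinates {
  rcD : forall x y, c (x + y) = c x + c y;
  rcM : forall x y, c (x * y) = c x * c y;
  rc_le : forall x y, (c x <= c y) = (x <= y);
  rc_norm : forall x, `|c x| = c `|x|;
  rc_real : forall e, 0 <= e -> e = c (re e);
  rc_re : real_functional c re;
  rc_im : real_functional c im;
  rcE : forall z, z = c (re z) + i * c (im z);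
  rc_i : `|i| <= 1 }.

Lemma real_or_complex_coordinates (F : numFieldType) : real_or_complex F ->
  exists (R : realType) (c : R -> F) re im i, real_coordinates c re im i.
Proof.
case=> R.
  exists R, id, id, (fun=> 0), 0; split => //.
  - split=> //; [by move=> *; rewrite subr0 | by move=> *; rewrite mulr0 |].
    by move=> x; rewrite normr0.
  - by move=> z; rewrite mul0r addr0.
  - by rewrite normr0.
exists R, (fun r => r%:C%C), (@complex.Re R), (@complex.Im R), 'i%C; split.
- by move=> x y; rewrite rmorphD.
- by move=> x y; rewrite rmorphM.
- by move=> x y; rewrite lecR.
- by move=> x; rewrite normc_def /= expr0n /= addr0 sqrtr_sqr.
- by move=> e e0; rewrite RRe_real // ger0_real.
- split; first by move=> x y; rewrite raddfB.
    by move=> r [x y] /=; rewrite mul0r subr0.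
  exact: normc_ge_Re.
- split; first by move=> x y; rewrite raddfB.
    by move=> r [x y] /=; rewrite mul0r addr0.
  by move=> x; rewrite normc_def lecR -sqrtr_sqr ler_wsqrtr // lerDr sqr_ge0.
- exact: complexE.
- by rewrite normc_def /= expr0n /= add0r expr1n sqrtr1.
Qed.

Section RealCoordinates.
Variables (F : numFieldType) (R : realType) (c : R -> F).
Variables (re im : F -> R) (i : F).
Hypothesis H : real_coordinates c re im i.

Lemma rc0 : c 0 = 0.
Proof. by apply: (addrI (c 0)); rewrite -(rcD H) !addr0. Qed.

Lemma rc_inj : injective c.
Proof. by move=> x y xy; apply/le_anti; rewrite -!(rc_le H) xy lexx. Qed.

Lemma rc_lt x y : (c x < c y) = (x < y).
Proof. by rewrite !lt_def (rc_le H) (inj_eq rc_inj). Qed.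

Lemma rc1 : c 1 = 1.
Proof.
have c1 : c 1 != 0 by rewrite -rc0 (inj_eq rc_inj) oner_eq0.
by apply: (mulfI c1); rewrite -(rcM H) !mulr1.
Qed.

Lemma rcV x : c x^-1 = (c x)^-1.
Proof.
have [->|x0] := eqVneq x 0; first by rewrite !(invr0, rc0).
have cx0 : c x != 0 by rewrite -rc0 (inj_eq rc_inj).
by apply: (mulfI cx0); rewrite -(rcM H) !divff // rc1.
Qed.

Lemma rc_gt0 e : 0 < e -> exists2 r, 0 < r & e = c r.
Proof.
move=> e0; have E := rc_real H (ltW e0); exists (re e) => //.
by rewrite -rc_lt rc0 -E.
Qed.

Lemma rc_dnbhs0 : c r @[r --> 0^'] --> 0^'.
Proof.
move=> S [e /= /rc_gt0[r r0 ->] HS]; exists r => //= x /= xr x0.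
apply: HS; first by move: xr; rewrite /= !sub0r !normrN (rc_norm H) rc_lt.
by rewrite -rc0 (inj_eq rc_inj).
Qed.

Section Functional.
Variable phi : F -> R.
Hypothesis P : real_functional c phi.

Lemma rf_cvg (T : Type) (G : set_system T) (FG : Filter G) (u : T -> F) l :
  u @ G --> l -> phi (u x) @[x --> G] --> phi l.
Proof.
move=> /cvgrPdist_lt ul; apply/cvgrPdist_lt => e e0.
have ce0 : 0 < c e by rewrite -rc0 rc_lt.
apply: filterS (ul _ ce0) => x; rewrite -(rfB P) -rc_lt.
by apply: le_lt_trans; exact: (rf_le P).
Qed.

Lemma rf_is_derive (f : F -> F) (v a : F) (s : R) :
  derivable f (c s * v + a) 1 ->
  is_derive s 1 (fun r : R => phi (f (c r * v + a)))
    (phi (v * derive1 f (c s * v + a))).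
Proof.
move=> df; set w := c s * v + a.
have dfv : derivable f w v by apply/diff_derivable/derivable1_diffP.
rewrite -derive_scale //.
have : (fun h : F => h^-1 *: (f (h *: v + w) - f w)) @ 0^' --> 'D_v f w.
  exact: dfv.
(* The limit over increments in [F] is restricted to increments [c r]; then [phi], being continuous
   and R-linear, passes through the difference quotient. *)
move=> /(cvg_comp _ _ rc_dnbhs0) /rf_cvg L.
set g := fun r : R => _.
have {}L : h^-1 *: (g (h *: 1 + s) - g s) @[h --> 0^'] --> phi ('D_v f w).
  apply: cvg_trans L; apply: near_eq_cvg; near=> h => /=.
  rewrite -rcV -[_ *: _]/(_ * _) (rfM P) (rfB P) /g /w.
  by rewrite addrA -[_ *: v]/(_ * _) -mulrDl -(rcD H) -[h *: 1]/(h * 1) mulr1.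
split; first by apply/cvg_ex; exists (phi ('D_v f w)).
exact: cvg_lim L.
Unshelve. all: by end_near. Qed.

(** The mean value theorem with equality fails for complex-valued functions, so it is applied to the
    real function s |-> phi (f (a + s (b - a))) on [0, 1]. *)
Lemma rf_mean_value (f : F -> F) (a b : F) (m : R) :
  (forall s : R, 0 <= s <= 1 -> derivable f (c s * (b - a) + a) 1) ->
  (forall s : R, 0 <= s <= 1 ->
     `|(b - a) * derive1 f (c s * (b - a) + a)| <= c m) ->
  `|phi (f b) - phi (f a)| <= m.
Proof.
move=> df bf; set g := fun r : R => phi (f (c r * (b - a) + a)).
pose dg s := phi ((b - a) * derive1 f (c s * (b - a) + a)).
have gd (s : R) : 0 <= s <= 1 -> is_derive s 1 g (dg s).
  by move=> h; exact: rf_is_derive (df s h).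
have [||s] := @MVT_segment R g dg 0 1 ler01.
- move=> s sI; apply: gd.
  by move: sI; rewrite in_itv /= => /andP[/ltW-> /ltW->].
- apply: derivable_within_continuous => s; rewrite in_itv /= => sI.
  by have [] := gd s sI.
rewrite in_itv /= => sI.
rewrite subr0 mulr1 /g /dg rc0 rc1 mul0r add0r mul1r subrK => ->.
by rewrite -(rc_le H); apply: le_trans (bf s sI); exact: (rf_le P).
Qed.

Lemma rf_geometric_cvg (u : nat -> F) (m : R) :
  (forall n, `|u n.+1 - u n| <= c (m * 2^-1 ^+ n)) ->
  exists l : R, phi (u n) @[n --> \oo] --> l.
Proof.
move=> um.
have T : cvgn (series (telescope (phi \o u))).
  apply: normed_cvg; apply: (@series_le_cvg _ _ (geometric m 2^-1)) => [n|n|n|].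
  - exact: normr_ge0.
  - rewrite /geometric /=; apply: mulr_ge0; last by rewrite exprn_ge0.
    have := um 0%N; rewrite expr0 mulr1; move/(le_trans (normr_ge0 _)).
    by rewrite -rc0 (rc_le H).
  - rewrite /= /telescope /= -(rfB P) -(rc_le H).
    by apply: le_trans (um n); exact: (rf_le P).
  - apply: is_cvg_geometric_series.
    by rewrite ger0_norm ?invr_ge0 // invf_lt1 // ltr1n.
move: T; rewrite telescopeK => /cvg_ex[l L]; exists (l + phi (u 0%N)).
have : (phi (u n) - phi (u 0%N)) + phi (u 0%N) @[n --> \oo] --> l + phi (u 0%N).
  by apply: cvgD => //; exact: cvg_cst.
by under eq_fun do rewrite subrK.
Qed.

End Functional.

Lemma rc_norm_le z (e : R) : `|re z| <= e -> `|im z| <= e -> `|z| <= 2 * c e.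
Proof.
move=> re_e im_e; rewrite [z](rcE H); apply: le_trans (ler_normD _ _) _.
rewrite (mulr_natl _ 2) mulr2n; apply: lerD.
  by rewrite (rc_norm H) (rc_le H).
rewrite normrM -[leRHS]mul1r; apply: ler_pM => //; first exact: (rc_i H).
by rewrite (rc_norm H) (rc_le H).
Qed.

End RealCoordinates.

(* The factor 2 comes from bounding real and imaginary parts separately. *)
Lemma mean_value (F : numFieldType) (HF : real_or_complex F) (f : F -> F)
    (x rho M a b : F) :
  (forall s, ball x rho s -> derivable f s 1) ->
  (forall s, ball x rho s -> `|derive1 f s| <= M) ->
  ball x rho a -> ball x rho b -> `|f b - f a| <= 2 * (M * `|b - a|).
Proof.
move=> df bf Ba Bb.
have [R [c [re [im [i H]]]]] := real_or_complex_coordinates HF.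
have M0 : 0 <= M by apply: le_trans (bf a Ba).
have E := rc_real H (mulr_ge0 M0 (normr_ge0 (b - a))).
have B s : 0 <= s <= 1 -> ball x rho (c s * (b - a) + a).
  move=> /andP[s0 s1]; move: Ba Bb; rewrite -!ball_normE /= => Ba Bb.
  have -> : x - (c s * (b - a) + a) = c s * (x - b) + c (1 - s) * (x - a).
    have -> : c (1 - s) = 1 - c s.
      by apply/(canRL (addrK _)); rewrite -(rcD H) subrK (rc1 H).
    ring.
  apply: le_lt_trans (ler_normD _ _) _; rewrite !normrM !(rc_norm H).
  rewrite (ger0_norm s0) (@ger0_norm _ (1 - s)) ?subr_ge0 //.
  (* Convexity of the ball: strictness is taken from the summand with weight [s], so s = 0 is
     treated apart. *)
  have [->|sn0] := eqVneq s 0; first by rewrite subr0 (rc0 H) (rc1 H) mul0r add0r mul1r.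
  have -> : rho = c s * rho + c (1 - s) * rho.
    by rewrite -mulrDl -(rcD H) addrC subrK (rc1 H) mul1r.
  apply: ltr_leD.
    by rewrite ltr_pM2l // -(rc0 H) (rc_lt H) lt_def sn0.
  by apply: ler_wpM2l; [rewrite -(rc0 H) (rc_le H) subr_ge0 | exact: ltW].
have L phi : real_functional c phi -> `|phi (f b - f a)| <= re (M * `|b - a|).
  move=> P; rewrite (rfB P); apply: (rf_mean_value H P) => s sI.
    by apply: df; exact: B.
  by rewrite -E normrM mulrC ler_wpM2r // bf //; exact: B.
by rewrite E; apply: (rc_norm_le H); apply: L; [exact: rc_re H|exact: rc_im H].
Qed.

Lemma geometric_cvg (F : numFieldType) (HF : real_or_complex F) (u : nat -> F)
    (M : F) :
  (forall n, `|u n.+1 - u n| <= M * 2^-1 ^+ n) ->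
  exists l : F, u n @[n --> \oo] --> l.
Proof.
move=> uM; have [R [c [re [im [i H]]]]] := real_or_complex_coordinates HF.
have M0 : 0 <= M.
  by have := uM 0%N; rewrite expr0 mulr1; apply: le_trans.
have c2 : c 2 = 2 by rewrite !mulr2n (rcD H) (rc1 H).
have cu n : `|u n.+1 - u n| <= c (re M * 2^-1 ^+ n).
  suff <- : M * 2^-1 ^+ n = c (re M * 2^-1 ^+ n) by [].
  rewrite (rcM H) -(rc_real H M0); congr (_ * _); elim: n => [|n IH].
    by rewrite !expr0 (rc1 H).
  by rewrite !exprS (rcM H) -IH (rcV H) c2.
have [lr Lr] := rf_geometric_cvg H (rc_re H) cu.
have [li Li] := rf_geometric_cvg H (rc_im H) cu.
exists (c lr + i * c li); apply/cvgrPdist_lt => e /(rc_gt0 H)[r r0 ->].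
have r40 : 0 < r / 4 by rewrite divr_gt0.
move/cvgrPdist_lt : Lr => /(_ _ r40) Lr; move/cvgrPdist_lt : Li => /(_ _ r40) Li.
near=> n.
have cN x y : c (x - y) = c x - c y.
  by apply/(canRL (addrK _)); rewrite -(rcD H) subrK.
have -> : c lr + i * c li - u n = c (lr - re (u n)) + i * c (li - im (u n)).
  by rewrite {1}[u n](rcE H) !cN; ring.
have hr : `|c (lr - re (u n))| <= c (r / 4).
  by rewrite (rc_norm H) (rc_le H) ltW //; near: n.
have hi : `|c (li - im (u n))| <= c (r / 4).
  by rewrite (rc_norm H) (rc_le H) ltW //; near: n.
apply: le_lt_trans (ler_normD _ _) _; rewrite normrM.
apply: (@le_lt_trans _ _ (c (r / 4) + c (r / 4))).
  apply: lerD => //; rewrite -[leRHS]mul1r; apply: ler_pM => //; exact: (rc_i H).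
by rewrite -(rcD H) (rc_lt H); lra.
Unshelve. all: by end_near. Qed.

(** * Inverse functions of one variable *)

Lemma le_half_add (F : numFieldType) (x y : F) : x <= x / 2 + y -> x <= 2 * y.
Proof.
move=> xy; have : x / 2 <= y by rewrite -(lerD2l (x / 2)) -splitr.
by rewrite ler_pdivrMr // mulrC.
Qed.

Lemma open_ballP (F : numFieldType) (U : set F) (x : F) : open U -> U x ->
  exists2 rho, 0 < rho & ball x rho `<=` U.
Proof.
by move=> oU Ux; have /nbhs_ballP[e e0 B] := open_nbhs_nbhs (conj oU Ux); exists e.
Qed.

Section InverseFunction.
Variables (F : numFieldType) (HF : real_or_complex F).
Variables (tau : F -> F) (t0 rho : F).
Let B := ball t0 rho.
Let c := derive1 tau t0.
Hypothesis stau : smooth_on B tau.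
Hypothesis c0 : c != 0.
Hypothesis tau_near : forall s, B s -> `|derive1 tau s - c| <= `|c| / 4.

(** Newton map with the derivative frozen at [t0]. By [tau_near] its derivative 1 - tau'/c is at
    most 1/4, and the factor 2 lost in [mean_value] still leaves the contraction constant 1/2. *)
Let h s := s - tau s / c.

Let open_B : open B. Proof. exact: ball_open. Qed.

Let h_lip a b : B a -> B b -> `|h b - h a| <= `|b - a| / 2.
Proof.
move=> Ba Bb.
have dh s : B s -> is_derive s 1 h (1 - derive1 tau s / c).
  move=> Bs; have dt : is_derive s 1 tau (derive1 tau s).
    rewrite derive1E; apply: derivableP; exact: smooth_on_derivable stau Bs.
  have -> : h = id - c^-1 *: tau.
    by apply/funext => r; rewrite /h mulrC.
  by rewrite mulrC; apply: is_deriveB; apply: is_deriveZ.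
have : `|h b - h a| <= 2 * (4^-1 * `|b - a|).
  apply: (mean_value HF (x := t0) (rho := rho)) => // s Bs.
    by have [] := dh s Bs.
  have [_ D] := dh s Bs; rewrite derive1E D.
  rewrite -[X in X - _](divff c0) -mulrBl normrM normfV distrC.
  by rewrite ler_pdivrMr ?normr_gt0 // mulrC tau_near.
move=> /le_trans; apply; rewrite mulrA.
by rewrite (_ : 2 / 4 = 2^-1) ?(mulrC _ 2^-1) //; field.
Qed.

(** In b - a = (h b - h a) + (tau b - tau a)/c the first summand is absorbed into half of the left
    side. This yields both injectivity of [tau] and a Lipschitz bound for its inverse. *)
Let tau_expand a b : B a -> B b -> `|b - a| <= 2 * (`|tau b - tau a| / `|c|).
Proof.
move=> Ba Bb; apply: le_half_add.
have E : b - a = (h b - h a) + (tau b - tau a) / c by rewrite /h; ring.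
have := ler_normD (h b - h a) ((tau b - tau a) / c).
by rewrite -E => /le_trans; apply; rewrite normf_div lerD2r; exact: h_lip.
Qed.

Let tau_inj a b : B a -> B b -> tau a = tau b -> a = b.
Proof.
move=> Ba Bb tab; apply/esym/eqP; rewrite -subr_eq0 -normr_le0.
by have := tau_expand Ba Bb; rewrite tab subrr normr0 mul0r mulr0.
Qed.

Let dtau_neq0 s : B s -> derive1 tau s != 0.
Proof.
move=> /tau_near; apply: contraTneq => ->.
rewrite sub0r normrN ler_pdivlMr // ger_pMr ?normr_gt0 //.
by rewrite lern1.
Qed.

(* y is reached by iterating the contraction s |-> h s + y / c from s0. *)
Let tau_onto s0 eta y : B s0 -> 0 < eta -> ball s0 (2 * eta) `<=` B ->
  `|y - tau s0| <= `|c| * (eta / 2) ->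
  exists2 s, B s & tau s = y.
Proof.
move=> Bs0 eta0 sub yt.
pose u := fix u n := if n is m.+1 then h (u m) + y / c else s0.
have hs0 : h s0 + tau s0 / c = s0 by rewrite /h subrK.
have ye : `|(y - tau s0) / c| <= eta / 2.
  by rewrite normf_div ler_pdivrMr ?normr_gt0 // mulrC.
have inB s : `|s - s0| <= eta -> B s.
  move=> se; apply: sub; rewrite -ball_normE /= distrC.
  by apply: le_lt_trans se _; rewrite mulr_natl mulr2n ltrDl.
have ub n : `|u n - s0| <= eta.
  elim: n => [|n IH]; first by rewrite subrr normr0 ltW.
  have -> : u n.+1 - s0 = (h (u n) - h s0) + (y - tau s0) / c.
    by rewrite -[in LHS]hs0 /=; ring.
  apply: le_trans (ler_normD _ _) _; rewrite [leRHS]splitr lerD //.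
  by apply: le_trans (h_lip Bs0 (inB _ IH)) _; rewrite ler_pM2r ?invr_gt0.
have uB n : B (u n) := inB _ (ub n).
have du n : `|u n.+1 - u n| <= (eta / 2) * 2^-1 ^+ n.
  elim: n => [|n IH].
    rewrite expr0 mulr1 /=.
    suff -> : h s0 + y / c - s0 = (y - tau s0) / c by [].
    by rewrite -{2}hs0; ring.
  have -> : u n.+2 - u n.+1 = h (u n.+1) - h (u n) by rewrite /=; ring.
  apply: le_trans (h_lip (uB n) (uB n.+1)) _.
  by rewrite exprSr mulrA ler_pM2r ?invr_gt0.
have [l ul] := geometric_cvg HF du.
(* The iterates stay within [eta] of [s0] and one of them lies within [eta] of [l]; this is why a
   ball of radius [2 * eta] is assumed inside [B]. *)
have Bl : B l.
  apply: sub; rewrite -ball_normE /=.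
  move/cvgrPdist_lt : ul => /(_ _ eta0)[N _ /(_ N (leqnn N)) /= uN].
  have -> : s0 - l = (s0 - u N) + (u N - l) by ring.
  apply: le_lt_trans (ler_normD _ _) _; rewrite mulr_natl mulr2n.
  by rewrite ler_ltD 1?[`|_ - l|]distrC // distrC.
have hl : l = h l + y / c.
  have h1 : u n.+1 @[n --> \oo] --> l by rewrite cvg_shiftS.
  have ch : {for l, continuous h}.
    have ct := smooth_on_continuous stau Bl.
    exact: (cvgB (@cvg_id _ (nbhs l)) (cvgM ct (cvg_cst c^-1))).
  have h2 : u n.+1 @[n --> \oo] --> h l + y / c.
    apply: cvgD; last exact: cvg_cst.
    by apply: cvg_comp ul _; exact: ch.
  exact: cvg_unique h1 h2.
exists l => //; apply/eqP; move: hl; rewrite /h -addrA -[X in X = _]addr0.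
move=> /addrI/esym/eqP; rewrite addrC subr_eq0 => /eqP /(mulIf _) -> //.
by rewrite invr_eq0.
Qed.

(** A chosen preimage in [B], unambiguous by [tau_inj]; off the image the value [t0] is a mere
    default. *)
Definition local_inverse (y : F) : F := xget t0 [set s | B s /\ tau s = y].
Local Notation sigma := local_inverse.

Let sigmaP y : (tau @` B) y -> B (sigma y) /\ tau (sigma y) = y.
Proof.
move=> [s Bs ts].
by apply: (@xgetPex _ t0 [set s | B s /\ tau s = y]); exists s.
Qed.

Lemma local_inverseK s : B s -> sigma (tau s) = s.
Proof.
move=> Bs; have [|Bs' ts] := @sigmaP (tau s); first by exists s.
exact: tau_inj.
Qed.

Lemma local_diffeo_open : open (tau @` B).
Proof.
rewrite openE => _ [s Bs <-].
have [e e0 eB] := open_ballP open_B Bs.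
(* [tau_onto] is used with eta = e / 2, so that [2 * eta] is the radius [e] available in [B]. *)
apply/nbhs_ballP; exists (`|c| * (e / 2 / 2)).
  by rewrite /= mulr_gt0 ?normr_gt0 // !divr_gt0.
move=> y; rewrite -ball_normE /= distrC => /ltW yt.
have [||s' Bs' ts'] := tau_onto Bs _ _ yt; [by rewrite divr_gt0| |by exists s'].
by rewrite mulrC divfK.
Qed.

Let sigma_lip y1 y2 : (tau @` B) y1 -> (tau @` B) y2 ->
  `|sigma y1 - sigma y2| <= 2 * (`|y1 - y2| / `|c|).
Proof.
move=> /sigmaP[B1 t1] /sigmaP[B2 t2].
by have := tau_expand B2 B1; rewrite t1 t2.
Qed.

(** The quotient of [sigma] at [y] with increment z is the reciprocal of the quotient of [tau] at
    [s0] with increment [k z]. By [sigma_lip], [k z] tends to 0, and it is nonzero for z nonzero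
    because [tau] undoes [sigma]; so the limit along punctured neighbourhoods transfers. *)
Let is_derive_sigma y : (tau @` B) y ->
  is_derive y 1 sigma (derive1 tau (sigma y))^-1.
Proof.
move=> Ty; have [Bs ts] := sigmaP Ty; set s0 := sigma y in Bs ts *.
have nT : \forall z \near nbhs (0 : F), (tau @` B) (z + y).
  have /nbhs_ballP[e /= e0 eT] := open_nbhs_nbhs (conj local_diffeo_open Ty).
  apply/nbhs_ballP; exists e => // z; rewrite -ball_normE /= sub0r => he.
  by apply: eT; rewrite -ball_normE /= opprD addrCA subrr addr0.
pose k z := sigma (z + y) - s0.
have kk : k z @[z --> (0 : F)^'] --> (0 : F)^'.
  move=> S [e /= e0 HS].
  have nz : \forall z \near nbhs (0 : F), `|z| < `|c| * (e / 2).
    have d0 : 0 < `|c| * (e / 2) by rewrite mulr_gt0 ?normr_gt0 ?divr_gt0.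
    apply/nbhs_ballP; exists (`|c| * (e / 2)) => // z.
    by rewrite -ball_normE /= sub0r normrN.
  have {}nz := nbhs_dnbhs nz; have nT' := nbhs_dnbhs nT.
  change (\forall z \near (0 : F)^', S (k z)).
  near=> z; have z0 : z != 0 by near: z; exact: nbhs_dnbhs_neq.
  apply: HS.
    rewrite /= sub0r normrN.
    apply: (@le_lt_trans _ _ (2 * (`|z| / `|c|))).
      have Th : (tau @` B) (z + y) by near: z.
      by have := sigma_lip Th Ty; rewrite addrK.
    rewrite mulrC -ltr_pdivlMr // ltr_pdivrMr ?normr_gt0 // mulrC.
    by near: z.
  have [_ th] : B (sigma (z + y)) /\ tau (sigma (z + y)) = z + y.
    by apply: sigmaP; near: z.
  apply: contra_neq z0 => k0; apply: (addIr y); rewrite -th add0r -{2}ts.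
  by congr tau; apply/eqP; rewrite -subr_eq0; apply/eqP.
have q : (fun r : F => r^-1 *: (tau (r *: 1 + s0) - tau s0)) @ 0^' -->
    derive1 tau s0.
  rewrite derive1E; exact: (smooth_on_derivable stau Bs).
have FF : Filter (0 : F)^' := dnbhs_filter 0.
have q' := @cvgV _ _ _ FF _ _ (dtau_neq0 Bs) (cvg_comp _ _ kk q).
have L : z^-1 *: (sigma (z *: 1 + y) - sigma y) @[z --> (0 : F)^'] -->
    (derive1 tau s0)^-1.
  apply: cvg_trans q'; apply: near_eq_cvg.
  have nT' := nbhs_dnbhs nT; near=> z => /=.
  have [_ th] : B (sigma (z + y)) /\ tau (sigma (z + y)) = z + y.
    by apply: sigmaP; near: z.
  rewrite -![_ *: _]/(_ * _) !mulr1 {2}/k subrK th ts addrK -/(k z).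
  by rewrite invfM invrK mulrC.
split; first by apply/cvg_ex; exists (derive1 tau s0)^-1.
exact: cvg_lim L.
Unshelve. all: by end_near. Qed.

(** Bootstrap: sigma' = (1/tau') o sigma has as many derivatives as [sigma], so [sigma] has one
    more. *)
Lemma smooth_on_local_inverse : smooth_on (tau @` B) sigma.
Proof.
have dsig y : (tau @` B) y -> differentiable sigma y.
  by move=> /is_derive_sigma[+ _] => /derivable1_diffP.
elim=> [|n IH].
  by move=> y Ty; apply: differentiable_continuous; exact: dsig.
split=> [//|v]; have oT := local_diffeo_open.
apply: (@class_C_ext _ _ _ _
  (fun y => v * ((fun s => (derive1 tau s)^-1) \o sigma) y)) => //.
  move=> y Ty; have [ds E] := is_derive_sigma Ty.
  by rewrite derive_scale // derive1E E.
apply: class_CM => //; first exact: class_C_cst.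
apply: (class_C_comp oT _ _ IH); last first.
  apply: smooth_onV open_B dtau_neq0 _; exact: smooth_on_derive1.
by move=> y /sigmaP[].
Qed.

End InverseFunction.

Lemma inverse_function (F : numFieldType) (HF : real_or_complex F)
    (tau : F -> F) (U : set F) (t0 : F) :
  open U -> smooth_on U tau -> U t0 -> derive1 tau t0 != 0 ->
  exists (rho : F) (sigma : F -> F),
    [/\ 0 < rho, ball t0 rho `<=` U, open (tau @` ball t0 rho),
        forall s, ball t0 rho s -> sigma (tau s) = s &
        smooth_on (tau @` ball t0 rho) sigma].
Proof.
move=> oU stau Ut0 c0.
have cd := smooth_on_continuous (smooth_on_derive1 stau) Ut0.
have c40 : 0 < `|derive1 tau t0| / 4 by rewrite divr_gt0 ?normr_gt0.
have oN : nbhs t0 (U `&` [set s | `|derive1 tau s - derive1 tau t0| <=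
    `|derive1 tau t0| / 4]).
  apply: filterI; first exact: open_nbhs_nbhs.
  move/cvgrPdist_le : cd => /(_ _ c40).
  by apply: filterS => s /=; rewrite distrC.
have /nbhs_ballP[rho /= rho0 sub] := oN.
have subU : ball t0 rho `<=` U by move=> s /sub[].
have near s : ball t0 rho s ->
  `|derive1 tau s - derive1 tau t0| <= `|derive1 tau t0| / 4 by move=> /sub[].
have sB := smooth_on_sub subU stau.
exists rho, (local_inverse tau t0 rho); split => //.
- exact: local_diffeo_open.
- by move=> s Bs; apply: local_inverseK.
- exact: smooth_on_local_inverse.
Qed.

(** * Calculus on jet spaces *)

Lemma near_line (F : numFieldType) (V : normedModType F) (Om : set V) (z v : V) :
  open Om -> Om z -> \forall h \near nbhs (0 : F), Om (h *: v + z).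
Proof.
move=> oO Oz.
have : h *: v + z @[h --> (0 : F)] --> 0 *: v + z.
  exact: (cvgD (cvgZr_tmp (@cvg_id _ (nbhs (0 : F)))) (cvg_cst z)).
rewrite scale0r add0r => /(_ Om); apply.
exact: open_nbhs_nbhs.
Qed.

Lemma smooth_on_fst (F : numFieldType) (V W : normedModType F) (f : V -> F)
    (U : set V) (U' : set (V * W)) :
  (forall p, U' p -> U p.1) -> smooth_on U f -> smooth_on U' (fun p => f p.1).
Proof.
move=> UU; apply: (@smooth_on_affcomp _ _ _ fst fst) => //.
by move=> w; apply: linear_differentiable => p; exact: cvg_fst.
Qed.

Lemma smooth_on_snd (F : numFieldType) (V : normedModType F) 
    (U' : set (V * F)) :
  smooth_on U' (fun p => p.2).
Proof.
apply: (@smooth_on_affcomp _ _ _ snd snd setT _ id) => //.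
  by move=> w; apply: linear_differentiable => p; exact: cvg_snd.
move=> n; apply: (@class_C_aff _ _ _ _ _ id) => [p|v p]; first exact: ex_diff.
by rewrite deriveE ?diff_val.
Qed.

Section JetCalculus.
Variables (F : numFieldType) (r : nat).
Local Notation J := 'rV[F]_r.+2.
Implicit Types (z v : J) (G H : J -> F) (Om : set J).

Definition jet_mk (t : F) (g : nat -> F) : J :=
  \row_(i < r.+2) if (i : nat) is k.+1 then g k else t.

Lemma jet_t_mk t g : jet_t (jet_mk t g) = t.
Proof. by rewrite /jet_t mxE. Qed.

Lemma jet_x_mk t g k : (k <= r)%N -> jet_x k (jet_mk t g) = g k.
Proof. by move=> kr; rewrite /jet_x mxE inordK. Qed.

Lemma jet_tD z z' : jet_t (z + z') = jet_t z + jet_t z'.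
Proof. by rewrite /jet_t mxE. Qed.

Lemma jet_tZ a z : jet_t (a *: z) = a * jet_t z.
Proof. by rewrite /jet_t mxE. Qed.

Lemma jet_xD k z z' : jet_x k (z + z') = jet_x k z + jet_x k z'.
Proof. by rewrite /jet_x mxE. Qed.

Lemma jet_xZ k a z : jet_x k (a *: z) = a * jet_x k z.
Proof. by rewrite /jet_x mxE. Qed.

Lemma jet_x_sum k (I : Type) (s : seq I) (P : pred I) (f : I -> J) :
  jet_x k (\sum_(i <- s | P i) f i) = \sum_(i <- s | P i) jet_x k (f i).
Proof. by rewrite /jet_x summxE. Qed.

Lemma jet_t_sum (I : Type) (s : seq I) (P : pred I) (f : I -> J) :
  jet_t (\sum_(i <- s | P i) f i) = \sum_(i <- s | P i) jet_t (f i).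
Proof. by rewrite /jet_t summxE. Qed.

Definition dir_t : J := delta_mx 0 ord0.
Definition dir_x k : J := delta_mx 0 (inord k.+1).

Lemma jet_t_et : jet_t dir_t = 1. Proof. by rewrite /jet_t mxE !eqxx. Qed.

Lemma jet_x_et k : (k <= r)%N -> jet_x k dir_t = 0.
Proof. by move=> kr; rewrite /jet_x mxE eqxx -val_eqE /= inordK. Qed.

Lemma jet_t_ex k : (k <= r)%N -> jet_t (dir_x k) = 0.
Proof. by move=> kr; rewrite /jet_t mxE eqxx -val_eqE /= inordK. Qed.

Lemma jet_x_ex j k : (k <= r)%N -> (j <= r)%N -> jet_x j (dir_x k) = (j == k)%:R.
Proof. by move=> kr jr; rewrite /jet_x mxE eqxx -val_eqE /= !inordK. Qed.

Lemma jet_baseZD h v z : jet_base (h *: v + z) = h *: jet_base v + jet_base z.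
Proof. by rewrite /jet_base jet_tD jet_tZ jet_xD jet_xZ. Qed.

Lemma differentiable_jet_base z : differentiable (@jet_base F r) z.
Proof. by apply: differentiable_pair; exact: differentiable_coord. Qed.

Lemma smooth_on_coord Om i : smooth_on Om (fun z => z 0 i).
Proof.
move=> n; apply: (@class_C_aff _ _ _ _ _ (fun v => v 0 i)).
  by move=> p; exact: differentiable_coord.
move=> v p; rewrite (@derive_line _ _ F^o _ _ (fun w : F^o => w) p (p 0 i) v (v 0 i)).
  by rewrite deriveE ?diff_val.
by apply: nearW => h; rewrite !mxE.
Qed.

Lemma smooth_on_jet_x Om k : smooth_on Om (jet_x k).
Proof. exact: smooth_on_coord. Qed.

Lemma smooth_on_base Om (U : set (F * F)) (f : F * F -> F) :
  (forall z, Om z -> U (jet_base z)) -> smooth_on U f ->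
  smooth_on Om (fun z => f (jet_base z)).
Proof.
move=> OU; apply: (@smooth_on_affcomp _ _ _ (@jet_base F r) (@jet_base F r)) => //.
  exact: differentiable_jet_base.
by move=> w v h; exact: jet_baseZD.
Qed.

Lemma smooth_on_of_t Om (U : set F) (f : F -> F) :
  (forall z, Om z -> U (jet_t z)) -> smooth_on U f ->
  smooth_on Om (fun z => f (jet_t z)).
Proof.
move=> OU; apply: (@smooth_on_affcomp _ _ _ (@jet_t F r) (@jet_t F r)) => //.
  by move=> w; exact: differentiable_coord.
by move=> w v h; rewrite jet_tD jet_tZ.
Qed.

Lemma open_base (U : set (F * F)) : open U -> open [set z : J | U (jet_base z)].
Proof.
apply: open_comp => z _.
by apply: differentiable_continuous; exact: differentiable_jet_base.
Qed.

(* The direction of the vector field D_t at z. *)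
Definition jvec z : J := dir_t + \sum_(k < r) jet_x k.+1 z *: dir_x k.

Lemma jet_t_jvec z : jet_t (jvec z) = 1.
Proof.
rewrite jet_tD jet_t_et jet_t_sum big1 ?addr0 // => k _.
by rewrite jet_tZ jet_t_ex ?mulr0 // ltnW.
Qed.

Lemma jet_x_jvec k z : (k < r)%N -> jet_x k (jvec z) = jet_x k.+1 z.
Proof.
move=> kr; rewrite jet_xD jet_x_et 1?ltnW // add0r jet_x_sum.
rewrite (bigD1 (Ordinal kr)) //= jet_xZ jet_x_ex 1?ltnW // eqxx mulr1.
rewrite big1 ?addr0 // => j jk; rewrite jet_xZ jet_x_ex 1?ltnW //.
by have /negbTE := jk; rewrite -val_eqE /= eq_sym => ->; rewrite mulr0.
Qed.

(** At a fixed jet D_t becomes a single directional derivative, whence its sum and product rules. *)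
Lemma total_deriveE G z : differentiable G z -> total_derive G z = 'D_(jvec z) G z.
Proof.
move=> dG; rewrite /total_derive /jvec !(deriveE _ dG) linearD linear_sum.
congr (_ + _); apply: eq_bigr => k _.
by rewrite linearZ (deriveE _ dG).
Qed.

Lemma total_derive_near G H z : {near z, G =1 H} ->
  total_derive G z = total_derive H z.
Proof.
move=> GH; rewrite /total_derive (near_eq_derive _ GH); congr (_ + _).
by apply: eq_bigr => k _; rewrite (near_eq_derive _ GH).
Qed.

Lemma total_derive_ext Om G H z : open Om -> Om z ->
  (forall w, Om w -> G w = H w) -> total_derive G z = total_derive H z.
Proof.
move=> oO Oz GH; apply: total_derive_near.
by near=> w; apply: GH; near: w; exact: open_nbhs_nbhs.
Unshelve. all: by end_near. Qed.

Lemma derive_ext Om G H z v : open Om -> Om z ->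
  (forall w, Om w -> G w = H w) -> 'D_v G z = 'D_v H z.
Proof.
move=> oO Oz GH; apply: near_eq_derive.
by near=> w; apply: GH; near: w; exact: open_nbhs_nbhs.
Unshelve. all: by end_near. Qed.

Lemma smooth_on_total_derive Om G : open Om -> smooth_on Om G ->
  smooth_on Om (total_derive G).
Proof.
move=> oO sG; apply: smooth_onD => //; first exact: smooth_on_derive.
apply: smooth_on_sum => // k _; apply: smooth_onM => //.
  exact: smooth_on_jet_x.
exact: smooth_on_derive.
Qed.

Section Rules.
Variables (Om : set J) (G H : J -> F) (z : J).
Hypotheses (oO : open Om) (sG : smooth_on Om G) (sH : smooth_on Om H) (Oz : Om z).

Lemma total_deriveD :
  total_derive (fun w => G w + H w) z = total_derive G z + total_derive H z.
Proof.
have sGH := smooth_onD oO sG sH.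
rewrite (total_deriveE (smooth_on_differentiable sGH Oz)).
rewrite (total_deriveE (smooth_on_differentiable sG Oz)).
rewrite (total_deriveE (smooth_on_differentiable sH Oz)).
exact: deriveD_on sG sH Oz.
Qed.

Lemma total_deriveM :
  total_derive (fun w => G w * H w) z =
  G z * total_derive H z + H z * total_derive G z.
Proof.
have sGH := smooth_onM oO sG sH.
rewrite (total_deriveE (smooth_on_differentiable sGH Oz)).
rewrite (total_deriveE (smooth_on_differentiable sG Oz)).
rewrite (total_deriveE (smooth_on_differentiable sH Oz)).
exact: deriveM_on sG sH Oz.
Qed.

End Rules.

Lemma total_derive_jet_x k z : (k < r)%N -> total_derive (jet_x k) z = jet_x k.+1 z.
Proof.
move=> kr; rewrite total_deriveE; last exact: differentiable_coord.
rewrite -jet_x_jvec //.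
rewrite (@derive_line _ _ F^o _ _ (fun w : F^o => w) z (jet_x k z) _ (jet_x k (jvec z))).
  by rewrite deriveE ?diff_val.
by apply: nearW => h; rewrite jet_xD jet_xZ.
Qed.

Lemma derive_of_t (f : F -> F) v z : derivable f (jet_t z) 1 ->
  'D_v (fun w => f (jet_t w)) z = jet_t v * derive1 f (jet_t z).
Proof.
move=> df; rewrite -derive_scale //; apply: derive_line.
by apply: nearW => h; rewrite jet_tD jet_tZ.
Qed.

Lemma total_derive_of_t (f : F -> F) z : derivable f (jet_t z) 1 ->
  total_derive (fun w => f (jet_t w)) z = derive1 f (jet_t z).
Proof.
move=> df; rewrite total_deriveE; first by rewrite derive_of_t // jet_t_jvec mul1r.
apply: (@differentiable_comp _ _ _ _ (@jet_t F r)); first exact: differentiable_coord.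
exact/derivable1_diffP.
Qed.

Lemma derive_base (f : F * F -> F) v z :
  'D_v (fun w => f (jet_base w)) z = 'D_(jet_base v) f (jet_base z).
Proof. by apply: derive_line; apply: nearW => h; rewrite jet_baseZD. Qed.

End JetCalculus.

(** * Differential functions of bounded order *)

Section Dependence.
Variables (F : numFieldType) (r : nat) (Om : set 'rV[F]_r.+2).
Hypothesis oO : open Om.
Local Notation J := 'rV[F]_r.+2.
Implicit Types (z v : J) (G H : J -> F).

Definition agree m z z' :=
  jet_t z = jet_t z' /\ forall k, (k <= m)%N -> jet_x k z = jet_x k z'.

(** Order at most m, expressed by values and not by vanishing partial derivatives, which on a
    general open [Om] would be weaker. The value form allows comparison of distant jets and is
    closed under algebraic operations without any smoothness. *)
Definition depends m G := forall z z', Om z -> Om z' -> agree m z z' -> G z = G z'.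

Lemma depends_le m m' G : (m <= m')%N -> depends m G -> depends m' G.
Proof.
move=> mm dG z z' Oz Oz' [zt zx]; apply: dG => //; split => // k km.
by apply: zx; exact: leq_trans mm.
Qed.

Lemma dependsD m G H : depends m G -> depends m H -> depends m (fun z => G z + H z).
Proof. by move=> dG dH z z' Oz Oz' a; rewrite (dG _ _ Oz Oz' a) (dH _ _ Oz Oz' a). Qed.

Lemma dependsM m G H : depends m G -> depends m H -> depends m (fun z => G z * H z).
Proof. by move=> dG dH z z' Oz Oz' a; rewrite (dG _ _ Oz Oz' a) (dH _ _ Oz Oz' a). Qed.

Lemma dependsV m G : depends m G -> depends m (fun z => (G z)^-1).
Proof. by move=> dG z z' Oz Oz' a; rewrite (dG _ _ Oz Oz' a). Qed.

Lemma dependsX m G n : depends m G -> depends m (fun z => G z ^+ n).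
Proof. by move=> dG z z' Oz Oz' a; rewrite (dG _ _ Oz Oz' a). Qed.

Lemma depends_sum m n (G : nat -> J -> F) :
  (forall i, (i < n)%N -> depends m (G i)) -> depends m (fun z => \sum_(i < n) G i z).
Proof.
by move=> dG z z' Oz Oz' a; apply: eq_bigr => i _; apply: (dG i).
Qed.

Lemma depends_jet_x m k : (k <= m)%N -> depends m (jet_x k).
Proof. by move=> km z z' _ _ [_]; apply. Qed.

Lemma agreeZD m z z' h v : agree m z z' -> agree m (h *: v + z) (h *: v + z').
Proof.
move=> [zt zx]; split; first by rewrite !jet_tD zt.
by move=> k km; rewrite !jet_xD zx.
Qed.

(** Parallel lines through two agreeing jets consist of agreeing jets and stay in [Om] for small
    parameters, so the difference quotients coincide. *)
Lemma depends_derive m G v : depends m G -> depends m ('D_v G).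
Proof.
move=> dG z z' Oz Oz' a; apply: derive_line.
have nz := near_line v oO Oz; have nz' := near_line v oO Oz'.
near=> h; apply: dG; [by near: h | by near: h | exact: agreeZD].
Unshelve. all: by end_near. Qed.

Lemma derive_depends0 m G k z : depends m G -> (m < k <= r)%N -> Om z ->
  'D_(dir_x F r k) G z = 0.
Proof.
move=> dG /andP[mk kr] Oz.
rewrite (@derive_line _ _ J _ G (fun=> G z) z 0 _ 0); first exact: derive_cst.
have nz := near_line (dir_x F r k) oO Oz.
near=> h; apply: dG => //; first by near: h.
split; first by rewrite jet_tD jet_tZ jet_t_ex // mulr0 add0r.
move=> j jm; rewrite jet_xD jet_xZ jet_x_ex //; last first.
  by apply: leq_trans kr; apply: leq_trans jm _; exact: ltnW.
by rewrite ltn_eqF ?mulr0 ?add0r // (leq_ltn_trans jm).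
Unshelve. all: by end_near. Qed.

(* The part of D_t G without x^(m+1), when G has order m. *)
Definition Dhat m G z : F :=
  'D_(dir_t F r) G z + \sum_(k < m) jet_x k.+1 z * 'D_(dir_x F r k) G z.

Lemma depends_Dhat m G : depends m G -> depends m (Dhat m G).
Proof.
move=> dG; apply: dependsD; first exact: depends_derive.
apply: (@depends_sum _ _ (fun k z => jet_x k.+1 z * 'D_(dir_x F r k) G z)) => k km.
by apply: dependsM; [exact: depends_jet_x | exact: depends_derive].
Qed.

Lemma smooth_on_Dhat m G : smooth_on Om G -> smooth_on Om (Dhat m G).
Proof.
move=> sG; apply: smooth_onD => //; first exact: smooth_on_derive.
apply: smooth_on_sum => // k _; apply: smooth_onM => //.
  exact: smooth_on_jet_x.
exact: smooth_on_derive.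
Qed.

Lemma total_derive_depends m G z : depends m G -> (m < r)%N -> Om z ->
  total_derive G z = Dhat m G z + jet_x m.+1 z * 'D_(dir_x F r m) G z.
Proof.
move=> dG mr Oz; rewrite /total_derive /Dhat -addrA; congr (_ + _).
rewrite -(big_mkord predT (fun k => jet_x k.+1 z * 'D_(dir_x F r k) G z)).
rewrite (big_cat_nat (n := m.+1)) //= big_nat_recr //= big_mkord.
rewrite [X in _ + X]big1_seq ?addr0 // => k.
rewrite mem_index_iota /= => /andP[mk kr].
by rewrite (derive_depends0 dG) ?mulr0 // mk ltnW.
Qed.

Lemma depends_total_derive m G : depends m G -> (m < r)%N ->
  depends m.+1 (total_derive G).
Proof.
move=> dG mr z z' Oz Oz' a; rewrite !(total_derive_depends dG) //.
have a' : agree m z z' by split; [exact: a.1 | move=> k /leqW; exact: a.2].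
rewrite (depends_Dhat dG Oz Oz' a') (depends_derive _ dG Oz Oz' a').
by rewrite a.2.
Qed.

(** * The two highest coefficients of the prolonged variables *)

Section Structure.
Variables (m : nat) (P : J -> F) (y : nat -> J -> F).
Hypotheses (sP : smooth_on Om P) (P0 : forall z, Om z -> P z != 0)
  (dP : depends m P) (sy : smooth_on Om (y m)) (dy : depends m (y m))
  (yS : forall k z, Om z -> y k.+1 z = total_derive (y k) z / P z).

Let A := 'D_(dir_x F r m) (y m).
(** For n > 0 this is the coefficient of x^(n+m) in [y (n + m)]: every application of D_t / P raises
    the top variable and divides its coefficient by P. *)
Let Q n z := A z * (P z)^-1 ^+ n.

Let sA : smooth_on Om A. Proof. exact: smooth_on_derive. Qed.
Let dA : depends m A. Proof. exact: depends_derive. Qed.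
Let sPV : smooth_on Om (fun z => (P z)^-1). Proof. exact: smooth_onV. Qed.
Let dPV : depends m (fun z => (P z)^-1). Proof. exact: dependsV. Qed.

Let sQ n : smooth_on Om (Q n).
Proof. by apply: smooth_onM => //; exact: smooth_on_exp. Qed.

Let dQ n : depends m (Q n).
Proof. by apply: dependsM => //; exact: dependsX. Qed.

Let sx k : smooth_on Om (jet_x k). Proof. exact: smooth_on_jet_x. Qed.

(** [y m] may depend on x^(m) in any way, hence the start at [n.+1]: D_t of a function of order m is
    affine in x^(m+1), with slope its x^(m)-derivative. *)
Lemma prolong_leading n : (n.+1 + m <= r)%N ->
  exists R, [/\ smooth_on Om R, depends (n + m) R &
    forall z, Om z -> y (n.+1 + m) z = Q n.+1 z * jet_x (n.+1 + m) z + R z].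
Proof.
elim: n => [|n IH] nr.
  exists (fun z => Dhat m (y m) z / P z); split.
  - by apply: smooth_onM => //; exact: smooth_on_Dhat.
  - by apply: dependsM => //; exact: depends_Dhat.
  - move=> z Oz; rewrite !add1n yS // (total_derive_depends dy) // /Q expr1 /A.
    by ring.
have [R [sR dR ER]] := IH (ltnW nr).
exists (fun z => (jet_x (n.+1 + m) z * total_derive (Q n.+1) z
  + total_derive R z) / P z); split.
- apply: smooth_onM => //; apply: smooth_onD => //; last exact: smooth_on_total_derive.
  by apply: smooth_onM => //; exact: smooth_on_total_derive.
- apply: dependsM; last by apply: depends_le dPV; exact: leq_addl.
  apply: dependsD; last by apply: depends_total_derive dR _; exact: ltnW.
  apply: dependsM; first exact: depends_jet_x.
  apply: (@depends_le m.+1); first by rewrite addSn ltnS leq_addl.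
  apply: depends_total_derive (dQ _) _.
  by apply: leq_trans nr; rewrite !addSn !ltnS leqW // leq_addl.
- move=> z Oz; rewrite [LHS]yS //.
  rewrite (total_derive_ext oO Oz ER).
  have sQx := smooth_onM oO (sQ n.+1) (sx (n.+1 + m)).
  rewrite (total_deriveD oO sQx sR Oz).
  rewrite (total_deriveM oO (sQ n.+1) (sx _) Oz) total_derive_jet_x //.
  by rewrite /Q (exprSr _ n.+1) (addSn n.+1); ring.
Qed.

(** The quotient rule with denominators cleared; it is the source of the integer weights in the
    subleading coefficient. *)
Let DQ n z : Om z -> 'D_(dir_x F r m) (Q n) z * P z ^+ n.+1 =
  P z * 'D_(dir_x F r m) A z - n%:R * A z * 'D_(dir_x F r m) P z.
Proof.
move=> Oz; have p0 := P0 Oz; elim: n => [|n IH].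
  rewrite (@derive_ext _ _ _ _ A _ _ oO Oz) ?mul0r ?subr0 ?expr1 1?mulrC //.
  by move=> w _; rewrite /Q expr0 mulr1.
rewrite (@derive_ext _ _ _ _ (fun w => Q n w * (P w)^-1) _ _ oO Oz); last first.
  by move=> w _; rewrite /Q exprSr mulrA.
rewrite (deriveM_on _ (sQ n) sPV Oz) deriveV //; last exact: smooth_on_derivable sP Oz.
rewrite mulrDl [X in _ + X](_ : _ = 'D_(dir_x F r m) (Q n) z * P z ^+ n.+1); last first.
  by rewrite exprS; field.
rewrite IH /Q -[_ *: _]/(_ * _) !exprS -(natr1 n) exprVn.
by field; rewrite p0 expf_neq0.
Qed.

(* The term rho x^(m+1) x^(k-1) comes from D_t (Q_(k-1)) x^(k-1); for k = m+3
   the product x^(m+1) x^(m+1) at the previous step contributes rho twice. *)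
Lemma prolong_subleading n : (n.+2 + m <= r)%N ->
  exists (a b : nat) rho S R, [/\ (0 < a)%N, (0 < b)%N,
    [/\ smooth_on Om rho, smooth_on Om S & smooth_on Om R],
    [/\ depends m rho, depends m S & depends (n + m) R] &
    forall z, Om z ->
      y (n.+2 + m) z = Q n.+2 z * jet_x (n.+2 + m) z +
        (rho z * jet_x m.+1 z + S z) * jet_x (n.+1 + m) z + R z /\
      rho z * P z ^+ n.+3 = a%:R * (P z * 'D_(dir_x F r m) A z)
        - b%:R * (A z * 'D_(dir_x F r m) P z)].
Proof.
elim: n => [|n IH] nr.
  have [R [sR dR ER]] := @prolong_leading 0 (ltnW nr).
  (* Differentiating Q_1 x^(m+1) + R: the product x^(m+1) x^(m+1) arises only from D_t Q_1, and
     [DQ 1] gives both weights the value 1. *)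
  exists 1%N, 1%N, (fun z => 'D_(dir_x F r m) (Q 1) z / P z),
    (fun z => (Dhat m (Q 1) z + 'D_(dir_x F r m) R z) / P z),
    (fun z => Dhat m R z / P z).
  split=> //.
  - split; apply: smooth_onM => //; first exact: smooth_on_derive.
      by apply: smooth_onD => //; [exact: smooth_on_Dhat | exact: smooth_on_derive].
    exact: smooth_on_Dhat.
  - split; apply: dependsM => //; first exact: depends_derive.
      by apply: dependsD => //; [exact: depends_Dhat | exact: depends_derive].
    exact: depends_Dhat.
  - move=> z Oz; have mr : (m < r)%N by apply: leq_trans nr; rewrite !addSn.
    have sQx := smooth_onM oO (sQ 1) (sx (1 + m)).
    split.
      rewrite [LHS]yS // (total_derive_ext oO Oz ER).
      rewrite (total_deriveD oO sQx sR Oz) (total_deriveM oO (sQ 1) (sx _) Oz).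
      rewrite (total_derive_depends (dQ 1)) // (total_derive_depends dR) //.
      rewrite total_derive_jet_x //.
      by rewrite !add0n !add1n /Q (exprSr _ 1) add2n; ring.
    rewrite -[RHS]/(1 * _ - 1 * _) !mul1r -[X in _ - X]mul1r mulrA -(DQ 1 Oz).
    by rewrite (exprS _ 2); field; exact: P0.
have mr : (m < r)%N by apply: leq_trans nr; rewrite !addSn !ltnS !leqW // leq_addl.
have [a [b [rho [S [R [a0 b0 [srho sS sR] [drho dS dR] E]]]]]] := IH (ltnW nr).
have ER z Oz := (E z Oz).1.
pose c := (n == 0)%N.
pose T z := rho z * jet_x m.+1 z + S z.
have sT : smooth_on Om T by apply: smooth_onD => //; exact: smooth_onM.
(* D_t T, except that for n = 0 the summand rho x^(m+2) multiplies x^(m+1) and so belongs to the new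
   subleading term, not to the remainder. *)
pose tdT z := (if c then 0 else rho z * jet_x m.+2 z)
  + (jet_x m.+1 z * total_derive rho z + total_derive S z).
have stdT : smooth_on Om tdT.
  apply: smooth_onD => //.
    by case: (c); [exact: smooth_on_cst | exact: smooth_onM].
  apply: smooth_onD => //; last exact: smooth_on_total_derive.
  by apply: smooth_onM => //; exact: smooth_on_total_derive.
(* The weights add up c + 1 copies of the previous relation and the relation [DQ n.+2], whose
   weights are 1 and n + 2. *)
exists (c * a + a).+1, (c * b + b + n.+2)%N,
  (fun z => ((if c then rho z else 0) + rho z + 'D_(dir_x F r m) (Q n.+2) z) / P z),
  (fun z => (Dhat m (Q n.+2) z + S z) / P z),
  (fun z => (jet_x (n.+1 + m) z * tdT z + total_derive R z) / P z).
split=> //.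
- by rewrite addnS.
- split; apply: smooth_onM => //; apply: smooth_onD => //.
  + by apply: smooth_onD => //; case: (c) => //; exact: smooth_on_cst.
  + exact: smooth_on_derive.
  + exact: smooth_on_Dhat.
  + exact: smooth_onM.
  + exact: smooth_on_total_derive.
- split.
  + apply: dependsM => //; apply: dependsD; last exact: depends_derive.
    by apply: dependsD => //; case: (c).
  + by apply: dependsM => //; apply: dependsD => //; exact: depends_Dhat.
  + apply: dependsM; last by apply: depends_le dPV; exact: leq_addl.
    apply: dependsD; last first.
      by apply: depends_total_derive dR _; apply: leq_trans nr; rewrite !addSn !ltnS leqW.
    apply: dependsM; first exact: depends_jet_x.
    have mn : (m.+1 <= n.+1 + m)%N by rewrite addSn ltnS leq_addl.
    apply: dependsD.
      rewrite /c; case: n {IH nr E ER c tdT stdT dR} mn => [|n] mn //=.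
      apply: dependsM; first by apply: depends_le drho; exact: leq_addl.
      by apply: depends_jet_x; rewrite !addSn !ltnS leq_addl.
    apply: dependsD; last by apply: depends_le mn _; exact: depends_total_derive.
    apply: dependsM; first exact: depends_jet_x.
    by apply: depends_le mn _; exact: depends_total_derive.
- move=> z Oz; have p0 := P0 Oz; split; last first.
    have /= D := DQ n.+2 Oz; have := (E z Oz).2.
    rewrite (exprS _ n.+3) => {}E.
    transitivity ((c%:R + 1) * (rho z * P z ^+ n.+3)
      + 'D_(dir_x F r m) (Q n.+2) z * P z ^+ n.+3).
      by case: (c) => /=; field.
    by rewrite D E -(natr1 (c * a + a)) !natrD !natrM; ring.
  rewrite [LHS]yS // (total_derive_ext oO Oz ER).
  have sQx := smooth_onM oO (sQ n.+2) (sx (n.+2 + m)).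
  have sTx := smooth_onM oO sT (sx (n.+1 + m)).
  rewrite (total_deriveD oO (smooth_onD oO sQx sTx) sR Oz).
  rewrite (total_deriveD oO sQx sTx Oz).
  rewrite (total_deriveM oO (sQ n.+2) (sx _) Oz) (total_deriveM oO sT (sx _) Oz).
  rewrite (total_deriveD oO (smooth_onM oO srho (sx _)) sS Oz).
  rewrite (total_deriveM oO srho (sx _) Oz).
  have nr2 : (n.+1 + m < r)%N by apply: leq_trans nr; rewrite !addSn.
  have mr1 : (m.+1 < r)%N by apply: leq_ltn_trans nr2; rewrite addSn ltnS leq_addl.
  rewrite (total_derive_depends (dQ n.+2)) // !total_derive_jet_x //.
  rewrite /T /tdT /c /Q (exprSr _ n.+2) (addSn n.+2).
  case: n {IH nr nr2 E ER c T sT tdT stdT sTx sQx dR} => [|n] /=.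
    by rewrite !addSn !add0n; ring.
  by rewrite !addSn; ring.
Qed.

End Structure.
End Dependence.

(** * Admissible transformations are affine in x *)

(* Vary x^(m+1) and x^(r-1), with x^(r) adjusted to stay on the locus.  If
   m+1 = r-1 the relation is quadratic in one variable, otherwise bilinear. *)
Lemma subleading_coef_eq0 (F : numFieldType) (s : nat)
    (Om : set 'rV[F]_s.+3.+2) (m : nat) (y : nat -> 'rV[F]_s.+3.+2 -> F) z
    (al al' : nat -> F) (be be' q rho S q' : F) R R' :
  (m.+2 <= s.+3)%N -> Om z ->
  (forall w, agree m z w -> Om w) ->
  (forall i, (i < s.+2)%N -> depends Om i (y i)) ->
  depends Om s.+1 R -> depends Om s.+1 R' ->
  (forall w, agree m z w -> y s.+2 w = q' * jet_x s.+2 w + R' w) ->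
  (forall w, agree m z w -> y s.+3 w =
     q * jet_x s.+3 w + (rho * jet_x m.+1 w + S) * jet_x s.+2 w + R w) ->
  (forall w, agree m z w ->
     jet_x s.+3 w + \sum_(2 <= i < s.+3) al i * jet_x i w = be ->
     y s.+3 w + \sum_(2 <= i < s.+3) al' i * y i w = be') ->
  rho = 0.
Proof.
move=> ms Oz Oinv dy dR dR' Ey' Ey loc.
(* The test jets. The order of the tests matters: for m = s + 1 the slots of [a] and [v] coincide
   and [v] wins. *)
pose W a v w : 'rV[F]_s.+3.+2 := jet_mk s.+3 (jet_t z) (fun k =>
  if (k <= m)%N then jet_x k z else if k == s.+3 then w else
  if k == s.+2 then v else if k == m.+1 then a else 0).
have ms1 : (m <= s.+1)%N by [].
have aW a v w : agree m z (W a v w).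
  split; first by rewrite jet_t_mk.
  by move=> k km; rewrite jet_x_mk ?km // (leq_trans km) // leqW // leqW.
have OW a v w := Oinv _ (aW a v w).
have WW a v w v' w' : agree s.+1 (W a v w) (W a v' w').
  split; first by rewrite !jet_t_mk.
  move=> k ks; have ks3 : (k <= s.+3)%N by rewrite leqW // leqW.
  rewrite !jet_x_mk //; case: ifP => // _.
  have -> : (k == s.+3) = false by lia.
  by have -> : (k == s.+2) = false by lia.
have Wr a v w : jet_x s.+3 (W a v w) = w.
  by rewrite jet_x_mk // eqxx leqNgt ltnW.
have Wr1 a v w : jet_x s.+2 (W a v w) = v.
  by rewrite jet_x_mk // eqxx leqNgt ltnS ms1 ltn_eqF.
have Wm a v w : jet_x m.+1 (W a v w) = if m == s.+1 then v else a.
  by rewrite jet_x_mk ?ltnn ?eqxx 1?ltnW //= eqSS ltn_eqF ?eqSS //=.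
pose X a := \sum_(2 <= i < s.+2) al i * jet_x i (W a 0 0).
pose Y a := \sum_(2 <= i < s.+2) al' i * y i (W a 0 0).
(* Eliminating x^(r) by the source equation leaves an identity in [a] and [v], in which the last
   bracket is independent of [v]. *)
have key a v : v * (rho * (if m == s.+1 then v else a)
      + (S - q * al s.+2 + al' s.+2 * q')) +
    (q * (be - X a) + R (W a 0 0) + al' s.+2 * R' (W a 0 0) + Y a - be') = 0.
  pose w := be - X a - al s.+2 * v.
  have EX : \sum_(2 <= i < s.+2) al i * jet_x i (W a v w) = X a.
    apply: eq_big_nat => i /andP[_ i2]; congr (_ * _).
    by apply: (WW a v w 0 0).2; rewrite -ltnS.
  have EY : \sum_(2 <= i < s.+2) al' i * y i (W a v w) = Y a.
    apply: eq_big_nat => i /andP[_ i2]; congr (_ * _); apply: (dy i) => //.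
    have [ht hx] := WW a v w 0 0; split => // k ki; apply: hx.
    by rewrite -ltnS (leq_ltn_trans ki).
  have := loc _ (aW a v w); rewrite !(big_nat_recr s.+2) //= EX EY Ey' // Ey //.
  rewrite Wr Wr1 Wm (dR _ _ (OW a v w) (OW a 0 0) (WW _ _ _ _ _)).
  rewrite (dR' _ _ (OW a v w) (OW a 0 0) (WW _ _ _ _ _)).
  have -> : w + (X a + al s.+2 * v) = be by rewrite /w; ring.
  move=> /(_ erefl) E; apply: (addIr be'); rewrite add0r -[RHS]E /w.
  move: (if _ then _ else _) (R _) (R' _) (X a) (Y a) => xi R0 R'0 X0 Y0.
  ring.
have [ms'|ms'] := eqVneq m s.+1.
  move: key; rewrite ms' eqxx => key.
  have k0 := key 0 0; have k1 := key 0 1; have k2 := key 0 (-1).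
  rewrite mul0r add0r in k0; rewrite k0 addr0 in k1; rewrite k0 addr0 in k2.
  (* A polynomial in v vanishing at 0, 1 and -1: its second difference is twice its quadratic
     coefficient. *)
  have E2 B : rho *+ 2 = 1 * (rho * 1 + B) + (-1) * (rho * -1 + B) by ring.
  have : rho *+ 2 = 0 by rewrite -[RHS](addr0 0) -[X in X + _]k1 -[X in _ + X]k2; exact: E2.
  by move/eqP; rewrite mulrn_eq0 => /eqP.
move: key; rewrite (negbTE ms') => key.
(* The values v = 0 and v = 1 isolate the coefficient of v; then a = 0 and a = 1 isolate rho. *)
have bracket a : rho * a + (S - q * al s.+2 + al' s.+2 * q') = 0.
  have := key a 0; rewrite mul0r add0r => k0.
  by have := key a 1; rewrite k0 addr0 mul1r.
have := bracket 0; rewrite mulr0 add0r => b0.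
by have := bracket 1; rewrite b0 addr0 mulr1.
Qed.

Lemma open_nonzero (F : numFieldType) (V : normedModType F) (U : set V)
    (f : V -> F) : open U -> smooth_on U f -> open [set z | U z /\ f z != 0].
Proof.
move=> oU sf; rewrite openE => z [Uz fz0].
have cf := smooth_on_continuous sf Uz.
have n0 : \forall w \near nbhs z, f w != 0 by exact: cvgr_neq0 cf fz0.
have nU : \forall w \near nbhs z, U w by exact: open_nbhs_nbhs.
by apply: filterS2 nU n0.
Qed.

(** * Prolonged variables of a point transformation *)

Section Prolongation.
Variables (F : numFieldType) (r : nat) (phi : transformation F).
Local Notation J := 'rV[F]_r.+2.
Local Notation D := (trans_dom phi).
Local Notation T := (trans_T phi).
Local Notation X := (trans_X phi).
Local Notation P := (DtT phi : J -> F).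
Local Notation y := (prolong_x phi : nat -> J -> F).
Hypothesis Hphi : point_transformation phi.
Hypothesis r0 : (0 < r)%N.

Let oD : open D. Proof. by case: Hphi. Qed.
Let sT : smooth_on D T. Proof. by case: Hphi. Qed.
Let sX : smooth_on D X. Proof. by case: Hphi. Qed.

Lemma jet_base_et : jet_base (dir_t F r) = (1, 0).
Proof. by rewrite /jet_base jet_t_et jet_x_et. Qed.

Lemma jet_base_ex0 : jet_base (dir_x F r 0) = (0, 1).
Proof. by rewrite /jet_base jet_t_ex // jet_x_ex. Qed.

Lemma jet_base_exS k : (k < r)%N -> jet_base (dir_x F r k.+1) = 0.
Proof. by move=> kr; rewrite /jet_base jet_t_ex // jet_x_ex. Qed.

Lemma agree_base m (z w : J) : agree m z w -> jet_base z = jet_base w.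
Proof. by move=> [zt /(_ 0 (leq0n m)) zx]; rewrite /jet_base zt zx. Qed.

Lemma total_derive_base (f : F * F -> F) (z : J) :
  total_derive (fun w => f (jet_base w)) z =
  'D_(1, 0) f (jet_base z) + jet_x 1 z * 'D_(0, 1) f (jet_base z).
Proof.
rewrite (@total_derive_depends _ _ setT _ 0) //; last first.
- by move=> z1 z2 _ _ a; rewrite (agree_base a).
- exact: openT.
by rewrite /Dhat big_ord0 addr0 !derive_base jet_base_et jet_base_ex0.
Qed.

(** The jets to which the second clause of [maps_ode] applies. *)
Definition regular_jets : set J := [set z | D (jet_base z) /\ P z != 0].
Local Notation Om := regular_jets.

Lemma DtTE z : P z = 'D_(1, 0) T (jet_base z) + jet_x 1 z * 'D_(0, 1) T (jet_base z).
Proof. exact: total_derive_base. Qed.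

Lemma open_regular_jets : open Om.
Proof.
have oB := @open_base F r _ oD; apply: (open_nonzero oB).
by apply: (smooth_on_total_derive oB); exact: (smooth_on_base _ sT).
Qed.
Local Notation oO := open_regular_jets.

Lemma smooth_on_DtT : smooth_on Om P.
Proof.
apply: smooth_on_total_derive oO _.
by apply: (smooth_on_base _ sT) => z [].
Qed.

Lemma smooth_on_prolong_x k : smooth_on Om (y k).
Proof.
elim: k => [|k IH]; first by apply: (smooth_on_base _ sX) => z [].
apply: smooth_on_div oO _ _ smooth_on_DtT; first by move=> z [].
exact: smooth_on_total_derive oO IH.
Qed.

Lemma depends_of_base (f : F * F -> F) : depends Om 0 (fun z => f (jet_base z)).
Proof. by move=> z1 z2 _ _ a; rewrite (agree_base a). Qed.

Lemma depends_DtT : depends Om 1 P.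
Proof.
apply: depends_total_derive => //; first exact: oO.
exact: depends_of_base.
Qed.

Lemma depends_prolong_x k : (k <= r)%N -> depends Om k (y k).
Proof.
elim: k => [_|k IH kr]; first exact: depends_of_base.
apply: dependsM; first exact: (depends_total_derive oO (IH (ltnW kr)) kr).
by apply: dependsV; apply: depends_le depends_DtT.
Qed.

Lemma jet_t_prolong (z : J) : jet_t (prolong phi z) = T (jet_base z).
Proof. by rewrite /prolong /jet_t mxE. Qed.

Lemma jet_x_prolong k (z : J) : (k <= r)%N -> jet_x k (prolong phi z : J) = y k z.
Proof. by move=> kr; rewrite /prolong /jet_x mxE inordK. Qed.

End Prolongation.

(** The conclusion is rho = 0 with powers of P cleared. The last two hypotheses ensure that the
    higher jet coordinates may vary freely while P and the coefficients of the top terms stay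
    fixed. *)
Lemma prolong_coef (F : numFieldType) (s : nat) (phi : transformation F)
    (E E' : arnold2_ode F) (m : nat) :
  point_transformation phi -> maps_ode s.+3 phi E E' -> (m <= 1)%N ->
  let Om := @regular_jets F s.+3 phi in
  let A := 'D_(dir_x F s.+3 m) (prolong_x phi m) in
  let P := DtT phi : 'rV[F]_s.+3.+2 -> F in
  depends Om m P ->
  (forall z w, Om z -> agree m z w -> Om w) ->
  exists a b : nat, [/\ (0 < a)%N, (0 < b)%N & forall z, Om z ->
    a%:R * (P z * 'D_(dir_x F s.+3 m) A z) = b%:R * (A z * 'D_(dir_x F s.+3 m) P z)].
Proof.
move=> Hphi [mdom mloc] m1 Om A P dP Oinv.
have oO := @open_regular_jets F s.+3 phi Hphi.
have sP := @smooth_on_DtT F s.+3 phi Hphi.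
have P0 z : Om z -> P z != 0 by case.
(* So that the orders r - 1 = s + 2 and r = s + 3 read [n.+1 + m] and [n.+2 + m]. *)
have [n En] : exists n, s.+1 = (n + m)%N by exists (s.+1 - m)%N; lia.
have sy := @smooth_on_prolong_x F s.+3 phi Hphi m.
have dy : depends Om m (prolong_x phi m).
  by apply: depends_prolong_x => //; rewrite -[s.+3]/(s.+1).+2 En; lia.
have yS k z : Om z -> prolong_x phi k.+1 z = total_derive (prolong_x phi k) z / P z.
  by [].
have [|R' [_ dR' ER']] := prolong_leading oO sP P0 dP sy dy yS (n := n).
  by rewrite -[s.+3]/(s.+1).+2 En; lia.
have [|a [b [rho [S [R [a0 b0 _ [drho dS dR] ER]]]]]] :=
  prolong_subleading oO sP P0 dP sy dy yS (n := n).
  by rewrite -[s.+3]/(s.+1).+2 En; lia.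
exists a, b; split => // z Oz; apply/eqP; rewrite -subr_eq0.
have [_ <-] := ER z Oz; rewrite mulf_eq0; apply/orP; left; apply/eqP.
have dA : depends Om m A by exact: depends_derive.
have dQ k : depends Om m (fun z => A z * (P z)^-1 ^+ k).
  by apply: dependsM => //; apply: dependsX; exact: dependsV.
pose t := jet_t z.
(* Jets agreeing with [z] up to order m share t and x, hence also tt, so the coefficients of both
   equations are constants along the test family. *)
apply: (@subleading_coef_eq0 F s Om m (prolong_x phi) z
  (fun i => ode_coef E i t) (fun i => ode_coef E' i (trans_T phi (jet_base z)))
  (ode_rhs E t) (ode_rhs E' (trans_T phi (jet_base z)))
  (A z * (P z)^-1 ^+ n.+2) (rho z) (S z) (A z * (P z)^-1 ^+ n.+1) R R') => //.
- by lia.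
- by move=> w; exact: Oinv.
- move=> i i2; apply: depends_prolong_x => //; by lia.
- by apply: depends_le dR; rewrite En.
- by apply: depends_le dR'; rewrite En.
- move=> w zw; have Ow := Oinv _ _ Oz zw.
  have := ER' w Ow; rewrite addSn -En => ->.
  by rewrite (dQ _ _ _ Oz Ow zw).
- move=> w zw; have Ow := Oinv _ _ Oz zw.
  have [+ _] := ER w Ow; rewrite !addSn -En => ->.
  by rewrite (dQ _ _ _ Oz Ow zw) (drho _ _ Oz Ow zw) (dS _ _ Oz Ow zw).
move=> w zw; have Ow := Oinv _ _ Oz zw; have [Dw Pw] := Ow.
have bw := agree_base zw; have tw : jet_t w = t by rewrite /t zw.1.
move=> Ew; have : ode_locus E w by split; [exact: (mdom _ Dw).1 | rewrite tw].
move=> /(mloc w Dw Pw)[_]; rewrite jet_t_prolong -bw jet_x_prolong //.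
move=> <-; congr (_ + _); apply: eq_big_nat => i /andP[_ i3].
by rewrite jet_x_prolong // ltnW.
Qed.

(** A ball of the product is a product of balls, so its fibres over t are balls and [mean_value]
    applies with M = 0. On a general open set the x-derivative would not control distant points of a
    fibre. *)
Lemma x_const (F : numFieldType) (HF : real_or_complex F) (f : F * F -> F)
    (p : F * F) rho :
  (forall q, ball p rho q -> differentiable f q) ->
  (forall q, ball p rho q -> 'D_(0, 1) f q = 0) ->
  forall t x x', ball p rho (t, x) -> ball p rho (t, x') -> f (t, x) = f (t, x').
Proof.
move=> df f0 t x x' [Bt Bx] [_ Bx'].
have dp (s : F) : differentiable (fun s : F => (t, s)) s.
  by apply: differentiable_pair.
have : `|f (t, x') - f (t, x)| <= 2 * (0 * `|x' - x|).
  apply: (@mean_value F HF (fun s => f (t, s)) p.2 rho) => // s Bs.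
    apply/derivable1_diffP.
    apply: (@differentiable_comp _ _ _ _ (fun s : F => (t, s)) f) => //.
    exact: df.
  rewrite derive1E (@derive_line _ F _ _ _ f s (t, s) 1 (0, 1)).
    by rewrite f0 ?normr0.
  apply: nearW => h; congr f; congr pair.
  by rewrite /= -[_ *: 0]/(h * 0) mulr0 add0r.
by rewrite mul0r mulr0 normr_le0 subr_eq0 => /eqP.
Qed.

Lemma derive_x_affine (F : numFieldType) r (c d : 'rV[F]_r.+2 -> F) (z : 'rV[F]_r.+2) :
  (0 < r)%N ->
  (forall w w', jet_base w = jet_base w' -> c w = c w') ->
  (forall w w', jet_base w = jet_base w' -> d w = d w') ->
  'D_(dir_x F r 1) (fun w => c w + jet_x 1 w * d w) z = d z.
Proof.
move=> r0 cb db.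
rewrite (@derive_line _ _ F _ _ (fun u : F => c z + u * d z) z (jet_x 1 z) _ 1).
  rewrite -derive1E.
  have H : is_derive (jet_x 1 z) 1 (cst (c z) + d z *: id) (0 + d z *: 1).
    by apply: is_deriveD; apply: is_deriveZ.
  have -> : (fun u : F => c z + u * d z) = cst (c z) + d z *: id.
    by apply/funext => u; rewrite mulrC.
  by rewrite derive1E; case: H => _ ->; rewrite add0r -[_ *: _]/(_ * _) mulr1.
apply: nearW => h; rewrite jet_xD jet_xZ jet_x_ex // mulr1.
have b : jet_base (h *: dir_x F r 1 + z) = jet_base z.
  by rewrite jet_baseZD jet_base_exS // scaler0 add0r.
by rewrite (cb _ _ b) (db _ _ b) -[_ *: _]/(_ * _) mulr1.
Qed.

(* At a point with T_x <> 0, x' can be chosen such that D_t T = 1. *)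
Lemma admissible_T_x (F : numFieldType) (s : nat) (phi : transformation F)
    (E E' : arnold2_ode F) :
  point_transformation phi -> maps_ode s.+3 phi E E' ->
  forall p, trans_dom phi p -> 'D_(0, 1) (trans_T phi) p = 0.
Proof.
move=> Hphi Hmap p Dp; apply/eqP/negPn/negP => Tx0.
have [oD _ sT sX J0] := Hphi.
set Tx := 'D_(0, 1) (trans_T phi) in Tx0.
set Tt := 'D_(1, 0) (trans_T phi).
set Xx := 'D_(0, 1) (trans_X phi); set Xt := 'D_(1, 0) (trans_X phi).
set Om := @regular_jets F s.+3 phi.
have oO : open Om by exact: open_regular_jets.
set P := DtT phi : 'rV[F]_s.+3.+2 -> F.
have PE (z : 'rV[F]_s.+3.+2) : P z = Tt (jet_base z) + jet_x 1 z * Tx (jet_base z).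
  exact: DtTE.
have sP : smooth_on Om P by exact: smooth_on_DtT.
have [||a [b [a0 b0 C]]] := prolong_coef Hphi Hmap (leqnn 1).
- exact: depends_DtT.
- move=> z w [Dz Pz] zw; have bw := agree_base zw.
  by rewrite /regular_jets /= -bw (DtTE phi) // -bw -zw.2 // -(DtTE phi).
pose x1 := (1 - Tt p) / Tx p.
pose z : 'rV[F]_s.+3.+2 := jet_mk s.+3 p.1 (fun k => if k == 0 then p.2 else
  if k == 1 then x1 else 0).
have bz : jet_base z = p by rewrite /jet_base jet_t_mk jet_x_mk //; case: (p).
have Pz : P z = 1 by rewrite PE bz jet_x_mk //= /x1 divfK // addrC subrK.
have Oz : Om z by split; [rewrite bz | rewrite -/P Pz oner_eq0].
have dP w : Om w -> 'D_(dir_x F s.+3 1) P w = Tx (jet_base w).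
  move=> Ow; rewrite (derive_ext _ oO Ow (fun w _ => PE w)).
  by rewrite derive_x_affine // => ? ? ->.
have P0 w : Om w -> P w != 0 by case.
have sPV : smooth_on Om (fun w => (P w)^-1) by exact: smooth_onV.
pose N (w : 'rV[F]_s.+3.+2) := Xt (jet_base w) + jet_x 1 w * Xx (jet_base w).
pose Ja := jacobian_TX phi.
have JE q : Ja q = Tt q * Xx q - Tx q * Xt q by [].
have sb f : smooth_on (trans_dom phi) f ->
    smooth_on Om (fun w : 'rV[F]_s.+3.+2 => f (jet_base w)).
  by move=> sf; apply: (smooth_on_base _ sf) => w [].
have sN : smooth_on Om N.
  apply: smooth_onD => //; first by apply: sb; exact: smooth_on_derive.
  apply: smooth_onM => //; first exact: smooth_on_jet_x.
  by apply: sb; exact: smooth_on_derive.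
have dPV w : Om w -> 'D_(dir_x F s.+3 1) (fun w => (P w)^-1) w
    = - (P w) ^- 2 * Tx (jet_base w).
  move=> Ow; rewrite deriveV ?dP //; first exact: P0.
  exact: smooth_on_derivable sP Ow.
(* [prolong_x phi 1] is N / P with both affine in x'; in X_x P - N T_x the terms with x' cancel and
   the Jacobian remains. *)
have AE w : Om w -> 'D_(dir_x F s.+3 1) (prolong_x phi 1) w =
    Ja (jet_base w) * ((P w)^-1 * (P w)^-1).
  move=> Ow; rewrite (@derive_ext _ _ _ _ (fun w => N w * (P w)^-1) _ _ oO Ow); last first.
    by move=> u Ou /=; rewrite total_derive_base.
  rewrite (deriveM_on _ sN sPV Ow) dPV // derive_x_affine //; [|by move=> ? ? ->..].
  rewrite JE /N PE.
  by field; rewrite -PE P0.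
have sJa : smooth_on (trans_dom phi) Ja.
  by apply: smooth_onB => //; apply: smooth_onM => //; exact: smooth_on_derive.
have dA : 'D_(dir_x F s.+3 1) ('D_(dir_x F s.+3 1) (prolong_x phi 1)) z =
    - 2 * (Ja p * Tx p).
  rewrite (derive_ext _ oO Oz AE).
  rewrite (deriveM_on _ (sb _ sJa) (smooth_onM oO sPV sPV) Oz).
  rewrite (deriveM_on _ sPV sPV Oz) dPV // Pz.
  have -> : 'D_(dir_x F s.+3 1) (fun w : 'rV[F]_s.+3.+2 => Ja (jet_base w)) z = 0.
    by rewrite derive_base jet_base_exS // derive0.
  by rewrite bz; field.
have := C z Oz; rewrite dA AE // dP // -/P Pz bz => CC.
(* At P = 1 the relation reads -2 a J T_x = b J T_x; as a > 0 and the characteristic is 0, J T_x = 0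
   follows, a contradiction. *)
have : (2 * a + b)%:R * (Ja p * Tx p) == 0.
  rewrite natrD natrM; apply/eqP; move: CC; set q := Ja p; set q' := Tx p => CC.
  have -> : (2 * a%:R + b%:R) * (q * q') =
    b%:R * (q * (1^-1 * 1^-1) * q') - a%:R * (1 * (- 2 * (q * q'))) by field.
  by rewrite CC subrr.
rewrite !mulf_eq0 (negbTE Tx0) (negbTE (J0 p Dp)) !orbF pnatr_eq0.
by rewrite addn_eq0 muln_eq0 (gtn_eqF a0).
Qed.

Lemma near_ball_line (F : numFieldType) (V : normedModType F) (q v : V) (rho : F) :
  0 < rho -> \forall h \near nbhs (0 : F), ball q rho (h *: v + q).
Proof.
by move=> rho0; apply: near_line; [exact: ball_open | exact: ballxx].
Qed.

Lemma admissible_T_const (F : numFieldType) (HF : real_or_complex F) (s : nat)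
    (phi : transformation F) (E E' : arnold2_ode F) :
  point_transformation phi -> maps_ode s.+3 phi E E' ->
  forall p rho, ball p rho `<=` trans_dom phi ->
  forall t x x', ball p rho (t, x) -> ball p rho (t, x') ->
  trans_T phi (t, x) = trans_T phi (t, x').
Proof.
move=> Hphi Hmap p rho sub; have [oD _ sT sX J0] := Hphi.
apply: (x_const HF) => q /sub Dq; first exact: smooth_on_differentiable sT Dq.
exact: admissible_T_x Hphi Hmap q Dq.
Qed.

(** Now P = T_t is a function of (t, x), which makes [prolong_coef] available for m = 0 with A =
    X_x; since T_tx = 0, it reduces to a P X_xx = 0. *)
Lemma admissible_X_xx (F : numFieldType) (HF : real_or_complex F) (s : nat)
    (phi : transformation F) (E E' : arnold2_ode F) :
  point_transformation phi -> maps_ode s.+3 phi E E' ->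
  forall p, trans_dom phi p -> 'D_(0, 1) ('D_(0, 1) (trans_X phi)) p = 0.
Proof.
move=> Hphi Hmap p Dp; have [oD _ sT sX J0] := Hphi.
set Tx := 'D_(0, 1) (trans_T phi); set Tt := 'D_(1, 0) (trans_T phi).
set Xx := 'D_(0, 1) (trans_X phi).
have Tx0 q : trans_dom phi q -> Tx q = 0 := admissible_T_x Hphi Hmap (p := q).
set Om := @regular_jets F s.+3 phi.
have oO : open Om by exact: open_regular_jets.
set P := DtT phi : 'rV[F]_s.+3.+2 -> F.
have PE (z : 'rV[F]_s.+3.+2) : trans_dom phi (jet_base z) -> P z = Tt (jet_base z).
  have -> : P z = Tt (jet_base z) + jet_x 1 z * Tx (jet_base z) by exact: DtTE.
  by move=> Dz; rewrite Tx0 // mulr0 addr0.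
have [||a [b [a0 b0 C]]] := prolong_coef Hphi Hmap (leq0n 1).
- by move=> z w [Dz _] [Dw _] zw; rewrite -/P !PE // (agree_base zw).
- move=> z w [Dz Pz] zw; have bw := agree_base zw.
  by rewrite /regular_jets /= -bw -/P PE -bw // -PE.
pose z : 'rV[F]_s.+3.+2 := jet_mk s.+3 p.1 (fun k => if k == 0 then p.2 else 0).
have bz : jet_base z = p by rewrite /jet_base jet_t_mk jet_x_mk //; case: (p).
have JE : jacobian_TX phi p = Tt p * Xx p.
  rewrite -[LHS]/(Tt p * Xx p - Tx p * 'D_(1, 0) (trans_X phi) p).
  by rewrite Tx0 // mul0r subr0.
have := J0 p Dp; rewrite JE mulf_eq0 negb_or => /andP[Tt0 Xx0].
have Pz : P z = Tt p by rewrite PE bz.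
have Oz : Om z by split; [rewrite bz | rewrite -/P Pz].
(* T_tx = 0 is obtained without interchanging derivatives: T does not depend on x on a ball, so
   neither do its difference quotients in t. *)
have dP : 'D_(dir_x F s.+3 0) P z = 0.
  have EP w : Om w -> P w = Tt (jet_base w) by move=> [Dw _]; rewrite PE.
  rewrite (derive_ext _ oO Oz EP) derive_base jet_base_ex0 bz.
  have /nbhs_ballP[rho /= rho0 sub] := open_nbhs_nbhs (conj oD Dp).
  rewrite (@derive_line _ _ F _ Tt (fun=> Tt p) p 0 (0, 1) 1); first exact: derive_cst.
  have near1 := near_ball_line (p.2 : F^o) (1 : F^o) rho0.
  near=> h.
  apply: derive_line.
  have near2 := near_ball_line (p.1 : F^o) (1 : F^o) rho0.
  near=> k.
  have Bh : ball p.2 rho (h *: 1 + p.2) by near: h.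
  have Bk : ball p.1 rho (k *: 1 + p.1) by near: k.
  rewrite (_ : k *: (1, 0) + (h *: (0, 1) + p) = (k *: 1 + p.1, h *: 1 + p.2)); last first.
    by congr pair => /=; rewrite ?scaler0 ?add0r.
  rewrite (_ : k *: (1, 0) + p = (k *: 1 + p.1, p.2)); last first.
    by congr pair => /=; rewrite ?scaler0 ?add0r.
  apply: (admissible_T_const HF Hphi Hmap sub); first by split.
  by split => //; exact: ballxx.
have := C z Oz; rewrite dP !mulr0 => /eqP.
rewrite !mulf_eq0 pnatr_eq0 (gtn_eqF a0) -/P Pz (negbTE Tt0) /=.
have EA (w : 'rV[F]_s.+3.+2) : 'D_(dir_x F s.+3 0) (prolong_x phi 0) w = Xx (jet_base w).
  by rewrite [LHS]derive_base jet_base_ex0.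
rewrite (derive_ext _ oO Oz (fun w _ => EA w)) derive_base jet_base_ex0 bz.
by move/eqP.
Unshelve. all: by end_near. Qed.

(** * Transformations affine in x *)

(** The derivative (d/dtt)^k for tt = tau(t), written in the variable t. *)
Definition tau_derive (F : numFieldType) (tau : F -> F) (k : nat) : (F -> F) -> F -> F :=
  iter k (fun (g : F -> F) t => derive1 g t / derive1 tau t).

(* The coefficient of f^(j) in tau_derive tau k (X1 f). *)
Fixpoint lin_coef (F : numFieldType) (tau X1 : F -> F) (k j : nat) : F -> F :=
  match k with
  | 0 => if j is 0 then X1 else fun=> 0
  | k'.+1 => fun t => (derive1 (lin_coef tau X1 k' j) t +
      (if j is i.+1 then lin_coef tau X1 k' i t else 0)) / derive1 tau t
  end.

Section LinearChange.
Variables (F : numFieldType) (U : set F) (tau X1 : F -> F).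
Hypotheses (oU : open U) (stau : smooth_on U tau) (sX1 : smooth_on U X1).
Hypothesis tau0 : forall t, U t -> derive1 tau t != 0.
Local Notation A := (lin_coef tau X1).
Local Notation Dl := (tau_derive tau).

Lemma tau_deriveS k g t : Dl k.+1 g t = derive1 (Dl k g) t / derive1 tau t.
Proof. by []. Qed.

Lemma tau_derive_ext k g h : (forall t, U t -> g t = h t) ->
  forall t, U t -> Dl k g t = Dl k h t.
Proof.
move=> gh; elim: k => [//|k IH] t Ut.
by rewrite !tau_deriveS (near_eq_derive1 oU IH Ut).
Qed.

Lemma smooth_on_tau_derive k g : smooth_on U g -> smooth_on U (Dl k g).
Proof.
move=> sg; elim: k => [//|k IH]; apply: smooth_on_div => //;
  exact: smooth_on_derive1.
Qed.

Lemma tau_derive_cst k c t : (0 < k)%N -> U t -> Dl k (fun=> c) t = 0.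
Proof.
elim: k t => [//|[|k] IH] t _ Ut; rewrite tau_deriveS.
  by rewrite derive1E derive_cst mul0r.
rewrite (near_eq_derive1 (g := fun=> 0) oU _ Ut); last by move=> s Us; exact: IH.
by rewrite derive1E derive_cst mul0r.
Qed.

Lemma tau_derive_tau1 t : U t -> Dl 1 tau t = 1.
Proof. by move=> Ut; rewrite /tau_derive /= divff // tau0. Qed.

Lemma tau_derive_tau k t : (1 < k)%N -> U t -> Dl k tau t = 0.
Proof.
case: k => [//|k] k1 Ut; rewrite /tau_derive iterSr -/(tau_derive tau k _).
rewrite (@tau_derive_ext _ _ (fun=> 1) tau_derive_tau1 _ Ut).
exact: tau_derive_cst.
Qed.

Lemma smooth_on_lin_coef k j : smooth_on U (A k j).
Proof.
elim: k j => [|k IH] [|j] //=; first exact: smooth_on_cst.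
  apply: smooth_on_div => //; last exact: smooth_on_derive1.
  apply: smooth_onD => //; first exact: smooth_on_derive1.
  exact: smooth_on_cst.
apply: smooth_on_div => //; last exact: smooth_on_derive1.
by apply: smooth_onD => //; exact: smooth_on_derive1.
Qed.

Lemma lin_coef_eq0 k j : (k < j)%N -> A k j = fun=> 0.
Proof.
elim: k j => [|k IH] [|j] //= kj; apply/funext => t.
have -> : A k j.+1 = fun=> 0 by apply: IH; exact: ltnW.
have -> : A k j = fun=> 0 by exact: IH.
by rewrite derive1E derive_cst add0r mul0r.
Qed.

Lemma lin_coef_diag k t : A k k t = X1 t / derive1 tau t ^+ k.
Proof.
elim: k => [|k IH]; first by rewrite /= expr0 divr1.
by rewrite /= lin_coef_eq0 // derive1E derive_cst add0r IH exprSr invfM mulrA.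
Qed.

(** Stated for an arbitrary sequence [x] so as to serve both the derivatives of a function and the
    jet coordinates. *)
Lemma lin_coef_step k t (x : nat -> F) :
  \sum_(j < k.+2) A k.+1 j t * x j =
  (\sum_(j < k.+1) (A k j t * x j.+1 + x j * derive1 (A k j) t)) / derive1 tau t.
Proof.
under eq_bigr do rewrite /= mulrAC.
rewrite -mulr_suml; congr (_ / _).
under eq_bigr do rewrite mulrDl.
rewrite !big_split /= addrC; congr (_ + _).
  by rewrite big_ord_recl mul0r add0r.
rewrite big_ord_recr /= lin_coef_eq0 // derive1E derive_cst mul0r addr0.
by apply: eq_bigr => j _; rewrite mulrC.
Qed.

Lemma tau_derive_mul f k t : smooth_on U f -> U t ->
  Dl k (fun s => X1 s * f s) t = \sum_(j < k.+1) A k j t * derive1n j f t.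
Proof.
move=> sf; elim: k t => [|k IH] t Ut; first by rewrite big_ord1.
rewrite tau_deriveS (near_eq_derive1 oU IH Ut) derive1E.
rewrite (derive_sum_on (f := fun j s => A k j s * derive1n j f s) _ oU) //; last first.
  move=> i _; apply: smooth_onM => //; first exact: smooth_on_lin_coef.
  exact: smooth_on_derive1n.
rewrite (lin_coef_step _ _ (fun j => derive1n j f t)); congr (_ / _); apply: eq_bigr => j _.
rewrite (deriveM_on _ (smooth_on_lin_coef _ _) (smooth_on_derive1n _ sf) Ut).
by rewrite -!derive1E.
Qed.

Lemma prolong_lin r (phi : transformation F) (X0 : F -> F) (W : set (F * F)) :
  open W -> (forall p, W p -> U p.1) -> smooth_on U X0 ->
  (forall p, W p -> trans_T phi p = tau p.1) ->
  (forall p, W p -> trans_X phi p = X1 p.1 * p.2 + X0 p.1) ->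
  forall k (z : 'rV[F]_r.+2), W (jet_base z) -> (k <= r)%N ->
  prolong_x phi k z =
  \sum_(j < k.+1) A k j (jet_t z) * jet_x j z + Dl k X0 (jet_t z).
Proof.
move=> oW WU sX0 ET EX.
have oO := @open_base F r W oW; set Om := [set z | W (jet_base z)] in oO.
have OU z : Om z -> U (jet_t z) by move=> /WU.
elim=> [|k IH] z Oz kr; first by rewrite big_ord1 /= EX.
have sf f : smooth_on U f -> smooth_on Om (fun w => f (jet_t w)).
  exact: smooth_on_of_t.
have df f : smooth_on U f -> derivable f (jet_t z) 1.
  by move=> s; apply: smooth_on_derivable s _; exact: OU.
have DT : DtT phi z = derive1 tau (jet_t z).
  rewrite /DtT (@total_derive_ext _ _ Om _ (fun w => tau (jet_t w)) _ oO Oz).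
    by rewrite total_derive_of_t //; exact: df.
  by move=> w Ow; rewrite ET.
have st j : smooth_on Om (fun w => A k j (jet_t w) * jet_x j w).
  apply: smooth_onM => //; last exact: smooth_on_jet_x.
  by apply: sf; exact: smooth_on_lin_coef.
have ss : smooth_on Om (fun w => \sum_(j < k.+1) A k j (jet_t w) * jet_x j w).
  by apply: smooth_on_sum => // j _; exact: st.
have sD := smooth_on_tau_derive k sX0.
rewrite /= DT (total_derive_ext oO Oz (fun w Ow => IH w Ow (ltnW kr))).
rewrite (total_deriveD oO ss (sf _ sD) Oz) total_derive_of_t ?df //.
rewrite mulrDl -tau_deriveS (lin_coef_step _ _ (fun j => jet_x j z)); congr (_ / _ + _).
rewrite (total_deriveE (smooth_on_differentiable ss Oz)).
rewrite (derive_sum_on (f := fun j w => A k j (jet_t w) * jet_x j w) 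
  _ oO (fun j _ => st j) Oz).
apply: eq_bigr => j _; have jr : (j < r)%N by apply: leq_trans kr; exact: ltn_ord.
rewrite -(total_deriveE (smooth_on_differentiable (st j) Oz)).
rewrite (total_deriveM oO (sf _ (smooth_on_lin_coef k j)) (@smooth_on_jet_x _ _ Om j) Oz).
rewrite total_derive_jet_x // total_derive_of_t //.
by apply: df; exact: smooth_on_lin_coef.
exact: df.
Qed.

End LinearChange.

Lemma jet_t_jet (F : numFieldType) r (f : F -> F) t : jet_t (jet r f t) = t.
Proof. exact: (@jet_t_mk F r t (fun k => derive1n k f t)). Qed.

Lemma jet_x_jet (F : numFieldType) r (f : F -> F) t k : (k <= r)%N ->
  jet_x k (jet r f t) = derive1n k f t.
Proof. exact: (@jet_x_mk F r t (fun k => derive1n k f t)). Qed.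

Lemma smooth_on_x_fixed (F : numFieldType) (f : F * F -> F) (U : set F)
    (D : set (F * F)) x0 :
  (forall t, U t -> D (t, x0)) -> smooth_on D f -> smooth_on U (fun t => f (t, x0)).
Proof.
move=> UD; apply: (@smooth_on_affcomp _ _ F (fun t => (t, x0)) (fun t => (t, 0))) => //.
by move=> w v h; congr pair; rewrite /= -[h *: 0]/(h * 0) mulr0 add0r.
Qed.

(** * From admissible transformations to the form with psi1 and psi2 *)

Section LinearAdmissible.
Variables (F : numFieldType) (r : nat) (phi : transformation F).
Variables (E E' : arnold2_ode F) (U : set F) (tau X1 X0 : F -> F) (W : set (F * F)).
Hypotheses (r2 : (2 <= r)%N) (Hmap : maps_ode r phi E E') (WD : W `<=` trans_dom phi).
Hypotheses (oU : open U) (stau : smooth_on U tau) (sX1 : smooth_on U X1)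
  (sX0 : smooth_on U X0) (tau0 : forall t, U t -> derive1 tau t != 0).
Hypotheses (oW : open W) (WU : forall p, W p -> U p.1)
  (ET : forall p, W p -> trans_T phi p = tau p.1)
  (EX : forall p, W p -> trans_X phi p = X1 p.1 * p.2 + X0 p.1).

(** Replacing x by x + e f adds e X1 f to xt, which by hypothesis leaves the derivatives of orders 2
    to r unchanged, so the target equation does not notice it. Subtracting the source equations at
    the two jets leaves e times the homogeneous equation for [f]. *)
Lemma symmetry_solution (f : F -> F) (p : F * F) : W p -> smooth_on U f ->
  (forall k, (2 <= k <= r)%N -> tau_derive tau k (fun s => X1 s * f s) p.1 = 0) ->
  ode_locus (homogeneous E) (jet r f p.1).
Proof.
move=> Wp sf f0; set t := p.1; have Ut := WU Wp.
have [domE loc] := Hmap.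
have Et : ode_dom E t := (domE p (WD Wp)).1.
have PL := prolong_lin oU stau sX1 tau0 oW WU sX0 ET EX (r := r).
(* A jet over [p] that lies on the source equation: x^(r) takes the value of the right-hand side and
   all middle derivatives vanish. *)
pose z0 : 'rV[F]_r.+2 := jet_mk r t (fun k => if k == 0 then p.2 else
  if k == r then ode_rhs E t else 0).
have bz0 : jet_base z0 = p by rewrite /jet_base jet_t_mk jet_x_mk //= -surjective_pairing.
have tz0 : jet_t z0 = t by rewrite jet_t_mk.
pose v : 'rV[F]_r.+2 := jet_mk r 0 (fun k => derive1n k f t).
(* The shift must keep the base point in [W], hence a small factor [e]; it must be nonzero to be
   cancelled at the end. *)
have [e e0 We] : exists2 e : F, e != 0 & W (e *: jet_base v + p).
  have nW := nbhs_dnbhs (near_line (jet_base v) oW Wp).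
  have [e [e0 We]] : exists e : F, e != 0 /\ W (e *: jet_base v + p).
    apply: (@filter_ex _ ((0 : F)^')); near=> e.
    by split; [near: e; exact: nbhs_dnbhs_neq | near: e].
  by exists e.
pose z := e *: v + z0.
have bz : jet_base z = e *: jet_base v + p by rewrite jet_baseZD bz0.
have tz : jet_t z = t by rewrite jet_tD jet_tZ jet_t_mk mulr0 add0r tz0.
have xz k : (k <= r)%N -> jet_x k z = e * derive1n k f t + jet_x k z0.
  by move=> kr; rewrite jet_xD jet_xZ jet_x_mk.
have Ek k : (2 <= k <= r)%N -> prolong_x phi k z = prolong_x phi k z0.
  move=> /andP[k2 kr]; rewrite !PL ?bz ?bz0 // tz tz0; congr (_ + _).
  have := f0 k; rewrite k2 kr (tau_derive_mul oU stau sX1 tau0) // => /(_ isT) S0.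
  have -> : \sum_(j < k.+1) lin_coef tau X1 k j t * jet_x j z =
      e * \sum_(j < k.+1) lin_coef tau X1 k j t * derive1n j f t +
      \sum_(j < k.+1) lin_coef tau X1 k j t * jet_x j z0.
    rewrite mulr_sumr -big_split; apply: eq_bigr => j _ /=.
    by rewrite xz; [ring | rewrite (leq_trans _ kr) // -ltnS].
  by rewrite S0 mulr0 add0r.
have PD w : W (jet_base w) -> DtT phi (w : 'rV[F]_r.+2) != 0.
  move=> Ww; have oO := @open_base F r W oW.
  rewrite /DtT (@total_derive_ext _ _ _ _ (fun w => tau (jet_t w)) _ oO Ww).
    by rewrite total_derive_of_t; [exact: tau0 (WU Ww) |
      exact: smooth_on_derivable stau (WU Ww)].
  by move=> u Wu; rewrite ET.
have iffE : ode_locus E z <-> ode_locus E z0.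
  rewrite (loc z) ?PD ?bz //; last exact: WD.
  rewrite (loc z0) ?PD ?bz0 //; last exact: WD.
  rewrite /ode_locus /= !jet_t_prolong bz bz0 !ET //.
  rewrite (_ : (e *: jet_base v + p).1 = p.1); last first.
    by rewrite /jet_base /= jet_t_mk scaler0 add0r.
  rewrite !jet_x_prolong // Ek ?r2 ?leqnn //.
  suff -> : \sum_(2 <= i < r) ode_coef E' i (tau p.1) * jet_x i (prolong phi z) =
     \sum_(2 <= i < r) ode_coef E' i (tau p.1) * jet_x i (prolong phi z0) by [].
  apply: eq_big_nat => i /andP[i2 ir].
  by rewrite !jet_x_prolong 1?ltnW // Ek // i2 ltnW.
have sum0 : \sum_(2 <= i < r) ode_coef E i t * jet_x i z0 = 0.
  apply: big1_seq => i /=; rewrite mem_index_iota => /andP[i2 ir].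
  by rewrite jet_x_mk 1?ltnW // (gtn_eqF (ltnW i2)) (ltn_eqF ir) mulr0.
have Ez0 : ode_locus E z0.
  split; first by rewrite tz0.
  by rewrite tz0 sum0 addr0 jet_x_mk // eqxx gtn_eqF // (leq_trans _ r2).
have [_] := iffE.2 Ez0; have [_] := Ez0; rewrite tz tz0 sum0 addr0 xz // => -> .
move=> Ez; split; rewrite /= ?jet_t_jet // jet_x_jet //.
have ES : \sum_(2 <= i < r) ode_coef E i t * jet_x i z =
    e * \sum_(2 <= i < r) ode_coef E i t * derive1n i f t.
  rewrite -[RHS]addr0 -[X in _ = _ + X]sum0 mulr_sumr -big_split; apply: eq_big_nat => i /=.
  by move=> /andP[_ ir]; rewrite xz 1?ltnW //; ring.
rewrite ES in Ez.
have : e * (derive1n r f t + \sum_(2 <= i < r) ode_coef E i t * derive1n i f t) = 0.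
  by apply: (addIr (ode_rhs E t)); rewrite add0r -[RHS]Ez; ring.
move/eqP; rewrite mulf_eq0 (negbTE e0) /= => /eqP E0.
rewrite -[RHS]E0; congr (_ + _).
by apply: eq_big_nat => i /andP[_ ir]; rewrite jet_x_jet 1?ltnW.
Unshelve. all: by end_near. Qed.

End LinearAdmissible.

Lemma admissible_A2_form (F : numFieldType) (HF : real_or_complex F) (s : nat)
    (phi : transformation F) (E E' : arnold2_ode F) (p : F * F) :
  point_transformation phi -> maps_ode s.+3 phi E E' -> trans_dom phi p ->
  exists W, [/\ open_nbhs p W, W `<=` trans_dom phi &
                A2_form s.+3 E (restrict_trans phi W)].
Proof.
move=> Hphi Hmap Dp; have [oD _ sT sX J0] := Hphi.
have [domE _] := Hmap.
have /nbhs_ballP[rho /= rho0 sub] := open_nbhs_nbhs (conj oD Dp).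
set W := ball p rho in sub; set U := ball p.1 rho.
have oW : open W by exact: ball_open.
have oU : open U by exact: ball_open.
have WU q : W q -> U q.1 by case.
have UW t : U t -> W (t, p.2) by move=> Ut; split => //; exact: ballxx.
have UD t : U t -> trans_dom phi (t, p.2) by move=> /UW/sub.
have Tx0 := admissible_T_x Hphi Hmap; have Xxx0 := admissible_X_xx HF Hphi Hmap.
(* All functions of t are read off along the horizontal line through [p], which meets every fibre of
   the box [W]. *)
pose tau t := trans_T phi (t, p.2).
pose X1 t := 'D_(0, 1) (trans_X phi) (t, p.2).
pose X0 t := trans_X phi (t, p.2) - X1 t * p.2.
have sXx : smooth_on (trans_dom phi) ('D_(0, 1) (trans_X phi)).
  exact: smooth_on_derive.
have stau : smooth_on U tau by exact: smooth_on_x_fixed UD sT.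
have sX1 : smooth_on U X1 by exact: smooth_on_x_fixed UD sXx.
have sX0 : smooth_on U X0.
  apply: smooth_onB => //; first exact: smooth_on_x_fixed UD sX.
  by apply: smooth_onM => //; exact: smooth_on_cst.
have ET q : W q -> trans_T phi q = tau q.1.
  case: q => t x Wq; apply: (admissible_T_const HF Hphi Hmap sub) => //.
  exact: UW (WU _ Wq).
have EXx q : W q -> 'D_(0, 1) (trans_X phi) q = X1 q.1.
  case: q => t x Wq.
  apply: (@x_const F HF ('D_(0, 1) (trans_X phi)) p rho _ _ t x p.2) => //.
  - by move=> q /sub Dq; apply: smooth_on_differentiable sXx Dq.
  - by move=> q /sub; exact: Xxx0.
  - exact: UW (WU _ Wq).
have EX q : W q -> trans_X phi q = X1 q.1 * q.2 + X0 q.1.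
  pose f (q : F * F) := trans_X phi q - X1 q.1 * q.2.
  have sXW := smooth_on_sub sub sX.
  have sX1W : smooth_on W (fun q => X1 q.1) by exact: smooth_on_fst sX1.
  have ss : smooth_on W (fun q : F * F => X1 q.1 * q.2).
    by apply: smooth_onM => //; exact: smooth_on_snd.
  have sf : smooth_on W f by apply: smooth_onB.
  have f0 q' : W q' -> 'D_(0, 1) f q' = 0.
    move=> Wq'; rewrite (deriveD_on _ sXW (smooth_onN oW ss) Wq').
    rewrite EXx //.
    rewrite (@derive_line _ _ F _ (fun q : F * F => - (X1 q.1 * q.2))
      (- X1 q'.1 *: id) q' q'.2 (0, 1) 1); last first.
      apply: nearW => h /=; rewrite scaler0 add0r.
      by rewrite -[RHS]/(- _ * _) mulNr.
    by rewrite deriveZ // derive_id -[_ *: 1]/(_ * _) mulr1 subrr.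
  case: q => t x Wq.
  have : f (t, x) = f (t, p.2).
    apply: (@x_const F HF f p rho) => //.
      by move=> q' Wq'; exact: smooth_on_differentiable sf Wq'.
    exact: UW (WU _ Wq).
  by rewrite /f /= -/(X0 t) => <-; rewrite addrC subrK.
have dtau t : U t -> derive1 tau t = 'D_(1, 0) (trans_T phi) (t, p.2).
  move=> Ut; rewrite derive1E; apply: derive_line; apply: nearW => h.
  by rewrite /tau; congr (trans_T phi (_, _)); rewrite /= scaler0 add0r.
have J0' t : U t -> derive1 tau t != 0 /\ X1 t != 0.
  move=> Ut; have := J0 _ (UD t Ut); rewrite /jacobian_TX Tx0; last exact: UD.
  by rewrite mul0r subr0 -dtau // mulf_eq0 negb_or => /andP.
have tau0 t (Ut : U t) := (J0' t Ut).1; have X10 t (Ut : U t) := (J0' t Ut).2.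
have projW : [set q.1 | q in W] = U.
  apply/seteqP; split => [_ [q Wq <-]|t Ut]; first exact: WU.
  by exists (t, p.2) => //; exact: UW.
pose psi1 t := (X1 t)^-1; pose psi2 t := tau t / X1 t.
have sp1 : smooth_on U psi1 by exact: smooth_onV.
have sp2 : smooth_on U psi2 by exact: smooth_on_div.
have Epsi t : U t -> psi2 t / psi1 t = tau t.
  by move=> Ut; rewrite /psi2 /psi1 invrK divfK // X10.
have X1psi1 t : U t -> X1 t * psi1 t = 1 by move=> Ut; rewrite divff // X10.
have X1psi2 t : U t -> X1 t * psi2 t = tau t.
  by move=> Ut; rewrite mulrC divfK // X10.
exists W; split; [by split => //; exact: ballxx | by [] |].
rewrite /A2_form /= projW; split => //.
- by exists p; exact: ballxx.
- by move=> t /UD/domE[].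
have sol := symmetry_solution (isT : (2 <= s.+3)%N) Hmap sub oU stau sX1 sX0
  tau0 oW WU ET EX.
exists psi1, psi2, X0; split => //.
- split; split => // t Ut; apply: (sol _ (t, p.2) (UW t Ut)) => // k /andP[k2 _].
    rewrite (tau_derive_ext tau oU k X1psi1 Ut).
    exact: (tau_derive_cst tau oU _ (ltnW k2) Ut).
  by rewrite (tau_derive_ext tau oU k X1psi2 Ut) (tau_derive_tau oU tau0).
(* Multiplied by X1, a linear relation becomes c + d tau = 0, and its derivative d tau' = 0 forces d
   = 0. *)
- move=> c d cd.
  have cd' t : U t -> c + d * tau t = 0.
    move=> Ut; have := cd t Ut; rewrite /psi1 /psi2 mulrA -mulrDl => /eqP.
    by rewrite mulf_eq0 invr_eq0 (negbTE (X10 t Ut)) orbF => /eqP.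
  have Up : U p.1 by exact: ballxx.
  have d0 : d = 0.
    have := near_eq_derive1 (g := fun=> 0) oU cd' Up.
    have dt : derivable tau p.1 1 by exact: smooth_on_derivable stau Up.
    rewrite !derive1E derive_cst.
    rewrite (_ : (fun t => _) = cst c + d *: tau) //.
    have dz : derivable (d *: tau) p.1 1 by exact: derivableZ.
    have dc : derivable (cst c : F -> F) p.1 1 by exact: derivable_cst.
    rewrite (deriveD dc dz).
    rewrite derive_cst add0r deriveZ // -derive1E => /eqP.
    by rewrite -[_ *: _]/(_ * _) mulf_eq0 (negbTE (tau0 _ Up)) orbF => /eqP.
  by have := cd' _ Up; rewrite d0 mul0r addr0.
- move=> _ [q Wq <-]; have Ut := WU q Wq.
  split; first by rewrite /psi1 invr_eq0 X10.
  by rewrite (near_eq_derive1 oU Epsi Ut) tau0.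
- move=> q Wq; split; first by rewrite ET // Epsi //; exact: WU.
  by rewrite EX // /psi1 invrK mulrC.
Qed.

(** The system is triangular with nonvanishing diagonal X1 / tau'^k, so the solution is smooth. The
    top component is kept explicit since its nonvanishing is needed to normalise the target
    equation. *)
Lemma lin_coef_solve (F : numFieldType) (U : set F) (tau X1 : F -> F)
    (N : nat) (l : nat -> F -> F) :
  open U -> smooth_on U tau -> smooth_on U X1 ->
  (forall t, U t -> derive1 tau t != 0) -> (forall t, U t -> X1 t != 0) ->
  (forall j, smooth_on U (l j)) ->
  exists m : nat -> F -> F,
    [/\ forall k, smooth_on U (m k),
        forall t j, U t -> (j <= N)%N ->
          \sum_(k < N.+1) m k t * lin_coef tau X1 k j t = l j t &
        forall t, U t -> m N t = l N t / lin_coef tau X1 N N t].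
Proof.
move=> oU stau sX1 tau0 X10; elim: N l => [|N IH] l sl.
  have A0 t : U t -> lin_coef tau X1 0 0 t != 0 by exact: X10.
  exists (fun k t => l 0 t / lin_coef tau X1 0 0 t); split => //.
    by move=> k; apply: smooth_on_div.
  by move=> t [|//] Ut _; rewrite big_ord1 /= divfK // X10.
set A := lin_coef tau X1.
have sA k j : smooth_on U (A k j) := smooth_on_lin_coef oU stau sX1 tau0 k j.
have A0 t : U t -> A N.+1 N.+1 t != 0.
  move=> Ut; rewrite /A lin_coef_diag mulf_neq0 ?X10 // invr_neq0 // expf_neq0 //.
  exact: tau0.
pose mN t := l N.+1 t / A N.+1 N.+1 t.
have smN : smooth_on U mN by exact: smooth_on_div.
(* The top unknown is fixed by the equation j = N + 1 alone; its contribution is moved to the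
   right-hand side of the others. *)
have [|m [sm Em _]] := IH (fun j t => l j t - mN t * A N.+1 j t).
  by move=> j; apply: smooth_onB => //; exact: smooth_onM.
exists (fun k => if k == N.+1 then mN else m k); split.
- by move=> k; case: ifP.
- move=> t j Ut; rewrite big_ord_recr /= eqxx leq_eqVlt => /orP[/eqP ->|jN].
    rewrite big1 ?add0r; first by rewrite /mN divfK // A0.
    by move=> k _; rewrite /A lin_coef_eq0 ?mulr0.
  rewrite -[RHS](subrK (mN t * A N.+1 j t)) -Em //; congr (_ + _).
  by apply: eq_bigr => k _; rewrite ltn_eqF.
- by move=> t Ut; rewrite eqxx.
Qed.

Lemma sum_ends (F : numFieldType) (r : nat) (f : nat -> F) : (2 <= r)%N ->
  \sum_(k < r.+1) f k = f 0 + f 1 + \sum_(2 <= k < r) f k + f r.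
Proof.
case: r => [|[|r]] // _; rewrite -(big_mkord predT f) big_nat_recr //=.
by rewrite big_ltn // big_ltn // !addrA.
Qed.

(** * Construction of the target equation *)

Section FormAdmissible.
Variables (F : numFieldType) (r : nat) (E : arnold2_ode F) (phi : transformation F).
Variables (V : set F) (psi1 psi2 X0 sigma : F -> F).
Local Notation tau := (fun s => psi2 s / psi1 s).
Local Notation X1 := (fun s => (psi1 s)^-1).
Hypotheses (r2 : (2 <= r)%N) (clE : class_A2 r E) (oV : open V)
  (VE : V `<=` ode_dom E).
Hypotheses (sol1 : solution_on r (homogeneous E) V psi1)
  (sol2 : solution_on r (homogeneous E) V psi2) (sX0 : smooth_on V X0).
Hypotheses (psi10 : forall t, V t -> psi1 t != 0)
  (tau0 : forall t, V t -> derive1 tau t != 0).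
Hypotheses (oT : open (tau @` V)) (sK : forall t, V t -> sigma (tau t) = t)
  (ssigma : smooth_on (tau @` V) sigma).

Lemma form_target (W : set (F * F)) : open W -> W !=set0 ->
  (forall p, W p -> V p.1) ->
  (forall p, W p -> trans_T phi p = tau p.1 /\ trans_X phi p = p.2 / psi1 p.1 + X0 p.1) ->
  exists E', equivalence_groupoid r (E, E', restrict_trans phi W).
Proof.
move=> oW Wn0 WV EW.
have [_ _ sa sb] := clE; have [sp1 L1] := sol1; have [sp2 L2] := sol2.
have sX1 : smooth_on V X1 by exact: smooth_onV.
have stau : smooth_on V tau by exact: smooth_on_div.
have X10 t : V t -> X1 t != 0 by move=> Vt; rewrite invr_eq0 psi10.
(* Coefficients of the source operator; the zeros at j = 0 and j = 1 express the second Arnold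
   form. *)
pose l j t : F := if j == r then 1 else
  if (2 <= j < r)%N then ode_coef E j t else 0.
have sl j : smooth_on V (l j).
  rewrite /l; case: eqP => _; first exact: smooth_on_cst.
  case j2 : (2 <= j < r)%N; last exact: smooth_on_cst.
  exact: (smooth_on_sub VE (sa j j2)).
have [m [sm Em mr]] := lin_coef_solve r oV stau sX1 tau0 X10 sl.
set A := lin_coef tau X1 in Em mr.
have mr0 t : V t -> m r t != 0.
  move=> Vt; rewrite mr // /l eqxx mulf_neq0 ?oner_eq0 // invr_neq0 //.
  rewrite /A lin_coef_diag mulf_neq0 ?X10 // invr_neq0 // expf_neq0 //.
  exact: tau0.
have lsum t (x : nat -> F) : \sum_(j < r.+1) l j t * x j =
    x r + \sum_(2 <= j < r) ode_coef E j t * x j.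
  rewrite (sum_ends (fun j => l j t * x j)) //.
  have -> : l 0 t = 0 by rewrite /l ltn_eqF // (leq_trans _ r2).
  have -> : l 1 t = 0 by rewrite /l ltn_eqF.
  have -> : l r t = 1 by rewrite /l eqxx.
  rewrite mul1r !mul0r !add0r.
  rewrite addrC; congr (_ + _); apply: eq_big_nat => j jr.
  by rewrite /l jr ltn_eqF //; case/andP: jr.
have swap t (x : nat -> F) : V t ->
    \sum_(k < r.+1) m k t * (\sum_(j < k.+1) A k j t * x j) =
    x r + \sum_(2 <= j < r) ode_coef E j t * x j.
  move=> Vt; rewrite -lsum.
  have widen (k : 'I_r.+1) : \sum_(j < k.+1) A k j t * x j = \sum_(j < r.+1) A k j t * x j.
    rewrite -!(big_mkord predT (fun j => A k j t * x j)).
    rewrite (big_cat_nat (n := k.+1) (p := r.+1)) //= [X in _ + X]big1_seq ?addr0 // => j.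
    by rewrite mem_index_iota /= => /andP[kj _]; rewrite /A lin_coef_eq0 // mul0r.
  under eq_bigr do rewrite widen mulr_sumr.
  rewrite exchange_big /=; apply: eq_bigr => j _.
  rewrite -(Em t j Vt (ltn_ord j)) mulr_suml.
  by apply: eq_bigr => k _; rewrite mulrA.
have Dsum t f : V t -> smooth_on V f -> ode_locus (homogeneous E) (jet r f t) ->
    \sum_(k < r.+1) m k t * tau_derive tau k (fun s => X1 s * f s) t = 0.
  move=> Vt sf [_] /=; rewrite jet_t_jet jet_x_jet // => Lf.
  under eq_bigr do rewrite (tau_derive_mul oV stau sX1 tau0) //.
  rewrite (swap t (fun j => derive1n j f t)) // -[RHS]Lf; congr (_ + _).
  by apply: eq_big_nat => j /andP[_ jr]; rewrite jet_x_jet // ltnW.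
have X1psi1 t : V t -> X1 t * psi1 t = 1 by move=> Vt; rewrite mulVf // psi10.
have X1psi2 t : V t -> X1 t * psi2 t = tau t by move=> Vt; rewrite mulrC.
(* X1 psi1 = 1 is annihilated by [tau_derive tau k] for every k > 0, so only the term with m_0
   survives. *)
have m0 t : V t -> m 0 t = 0.
  move=> Vt; have := Dsum t psi1 Vt sp1 (L1 t Vt).
  rewrite big_ord_recl big1; last first.
    move=> k _; rewrite (tau_derive_ext tau oV _ X1psi1) //.
    by rewrite (tau_derive_cst tau oV) ?mulr0.
  by rewrite addr0 (tau_derive_ext tau oV _ X1psi1) //= mulr1.
(* X1 psi2 = tau has first derivative 1 with respect to tt and vanishing higher ones; with m_0 = 0
   only m_1 survives. *)
have m1 t : V t -> m 1 t = 0.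
  move=> Vt; have := Dsum t psi2 Vt sp2 (L2 t Vt).
  rewrite big_ord_recl m0 // mul0r add0r.
  case: (r) r2 => [//|q] q1; rewrite big_ord_recl big1; last first.
    move=> k _; rewrite (tau_derive_ext tau oV _ X1psi2) //.
    by rewrite (tau_derive_tau oV tau0) ?mulr0.
  by rewrite addr0 (tau_derive_ext tau oV _ X1psi2) // (tau_derive_tau1 tau0) // mulr1.
pose coef k t := m k t / m r t.
have scoef k : smooth_on V (coef k) by exact: smooth_on_div.
(* The second summand is the target operator applied to the shift X0 contained in xt. *)
pose B t := ode_rhs E t / m r t + \sum_(k < r.+1) coef k t * tau_derive tau k X0 t.
have sB : smooth_on V B.
  apply: smooth_onD => //.
    by apply: smooth_on_div => //; exact: (smooth_on_sub VE sb).
  apply: smooth_on_sum => // k _; apply: smooth_onM => //.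
  exact: smooth_on_tau_derive.
have sig y : (tau @` V) y -> V (sigma y) by move=> [t Vt <-]; rewrite sK.
pose E' := Arnold2Ode (tau @` V) (fun i => coef i \o sigma) (B \o sigma).
have [p0 Wp0] := Wn0; have Vp0 := WV _ Wp0.
exists E'; split => /=.
- by [].
- split => //=.
  + by exists (tau p0.1), p0.1.
  + by move=> i _; exact: smooth_on_comp oT sig (scoef i) ssigma.
  + exact: smooth_on_comp oT sig sB ssigma.
- split => //=.
  + apply: (@smooth_on_ext _ _ _ (fun p : F * F => tau p.1)) => //.
      by move=> p Wp; rewrite (EW p Wp).1.
    exact: smooth_on_fst WV stau.
  + apply: (@smooth_on_ext _ _ _ (fun p : F * F => p.2 * X1 p.1 + X0 p.1)) => //.
      by move=> p Wp; rewrite (EW p Wp).2.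
    apply: smooth_onD => //; last exact: smooth_on_fst WV sX0.
    by apply: smooth_onM => //; [exact: smooth_on_snd | exact: smooth_on_fst WV sX1].
  + move=> p Wp; have Vp := WV p Wp; rewrite /jacobian_TX /=.
    have nW : \forall q \near nbhs p, W q by exact: open_nbhs_nbhs.
    have -> : 'D_(1, 0) (trans_T phi) p = derive1 tau p.1.
      rewrite (@near_eq_derive _ _ _ _ (fun q : F * F => tau q.1)); last first.
        by apply: filterS nW => q Wq; rewrite (EW q Wq).1.
      rewrite derive1E; apply: derive_line; apply: nearW => h.
      by [].
    have -> : 'D_(0, 1) (trans_T phi) p = 0.
      rewrite (@near_eq_derive _ _ _ _ (fun q : F * F => tau q.1)); last first.
        by apply: filterS nW => q Wq; rewrite (EW q Wq).1.
      rewrite (@derive_line _ _ F _ _ (fun=> tau p.1) p 0 (0, 1) 1).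
        exact: derive_cst.
      by apply: nearW => h /=; rewrite scaler0 add0r.
    have -> : 'D_(0, 1) (trans_X phi) p = X1 p.1.
      rewrite (@near_eq_derive _ _ _ _ (fun q : F * F => q.2 / psi1 q.1 + X0 q.1)); last first.
        by apply: filterS nW => q Wq; rewrite (EW q Wq).2.
      rewrite (@derive_line _ _ F _ _ (X1 p.1 *: id + cst (X0 p.1)) p p.2 (0, 1) 1).
        rewrite deriveD // deriveZ // derive_id derive_cst addr0.
        by rewrite -[_ *: 1]/(_ * _) mulr1.
      by apply: nearW => h /=; rewrite scaler0 add0r mulrC.
    by rewrite mul0r subr0 mulf_neq0 ?tau0 ?X10.
split=> /= [p Wp|z Wz DTz].
  by split; [exact: VE (WV p Wp) | rewrite (EW p Wp).1; exists p.1 => //; exact: WV].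
have EX p : W p -> trans_X (restrict_trans phi W) p = X1 p.1 * p.2 + X0 p.1.
  by move=> Wp; rewrite /= (EW p Wp).2 mulrC.
have ET p : W p -> trans_T (restrict_trans phi W) p = tau p.1.
  by move=> Wp; rewrite /= (EW p Wp).1.
have PL k kr := prolong_lin oV stau sX1 tau0 oW WV sX0 ET EX (r := r) (k := k) Wz kr.
set t := jet_t z in PL; have Vt : V t := WV _ Wz.
have mt0 := mr0 t Vt.
rewrite /ode_locus /= -/t jet_t_prolong ET //= sK //.
(* The left side of the target is that of the source divided by m_r, plus the X0-part of [B]; since
   m_r is nonzero, the two equations are equivalent. *)
have -> : jet_x r (prolong (restrict_trans phi W) z) + \sum_(2 <= i < r)
    coef i t * jet_x i (prolong (restrict_trans phi W) z) =
    (jet_x r z + \sum_(2 <= i < r) ode_coef E i t * jet_x i z) / m r t +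
    \sum_(k < r.+1) coef k t * tau_derive tau k X0 t.
  rewrite -(swap t (fun j => jet_x j z) Vt).
  have -> : jet_x r (prolong (restrict_trans phi W) z) + \sum_(2 <= i < r)
      coef i t * jet_x i (prolong (restrict_trans phi W) z) =
      \sum_(k < r.+1) coef k t * prolong_x (restrict_trans phi W) k z.
    rewrite (sum_ends (fun k => coef k t * prolong_x (restrict_trans phi W) k z)) //.
    rewrite /coef m0 // m1 // divff //.
    rewrite !mul0r !add0r mul1r addrC jet_x_prolong //; congr (_ + _).
    by apply: eq_big_nat => i /andP[_ ir]; rewrite jet_x_prolong // ltnW.
  rewrite mulr_suml -big_split /=; apply: eq_bigr => k _.
  by rewrite (PL _ (ltn_ord k)) -/A /coef mulrDr; congr (_ + _); rewrite mulrAC.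
rewrite /B; split => -[h1 h2]; split.
- by exists t.
- by rewrite h2.
- exact: VE.
- by move/addIr : h2 => /(mulIf _) ->; rewrite ?invr_eq0.
Qed.

End FormAdmissible.

Lemma lin_indep_on_1t (F : numFieldType) (U : set F) t :
  open U -> U t -> lin_indep_on U (fun=> 1) id.
Proof.
move=> oU Ut c d cd.
have d0 : d = 0.
  have dd : derivable (d *: id : F -> F) t 1 by exact: derivableZ.
  have dc : derivable (cst (c * 1) : F -> F) t 1 by exact: derivable_cst.
  have := near_eq_derive1 (g := fun=> 0) oU cd Ut.
  rewrite !derive1E derive_cst.
  rewrite (_ : (fun s => _) = cst (c * 1) + d *: id) //.
  by rewrite (deriveD dc dd) derive_cst add0r deriveZ // derive_id -[_ *: _]/(_ * _) mulr1.
by have := cd t Ut; rewrite d0 mul0r addr0 mulr1.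
Qed.

(** The domain is cut only in t, to a ball on which psi2/psi1 has a smooth inverse; affinity in x
    calls for no restriction on x. *)
Lemma A2_form_admissible (F : numFieldType) (HF : real_or_complex F) (r : nat)
    (E : arnold2_ode F) (phi : transformation F) (p : F * F) : (2 <= r)%N ->
  class_A2 r E -> A2_form r E phi -> trans_dom phi p ->
  exists W E', [/\ open_nbhs p W, W `<=` trans_dom phi &
                   equivalence_groupoid r (E, E', restrict_trans phi W)].
Proof.
move=> r2 clE [oD _ UE [psi1 [psi2 [X0 [[sol1 sol2] _ nz sX0 Ephi]]]]] Dp.
have /nbhs_ballP[e /= e0 sub] := open_nbhs_nbhs (conj oD Dp).
set U := [set q.1 | q in trans_dom phi] in sol1 sol2 nz sX0 UE.
have VU : ball p.1 e `<=` U.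
  by move=> t Vt; exists (t, p.2) => //; apply: sub; split => //; exact: ballxx.
have [s1 L1] := sol1; have [s2 L2] := sol2.
have oV0 : open (ball p.1 e) by exact: ball_open.
have Vp : ball p.1 e p.1 by exact: ballxx.
have stau0 : smooth_on (ball p.1 e) (fun s => psi2 s / psi1 s).
  apply: smooth_on_div => //; first by move=> t /VU/nz[].
    exact: (smooth_on_sub VU s2).
  exact: (smooth_on_sub VU s1).
have [rho [sigma [rho0 BV oT sK ssig]]] :=
  inverse_function HF oV0 stau0 Vp (nz _ (VU _ Vp)).2.
set V := ball p.1 rho in BV oT sK ssig.
have VU' : V `<=` U by move=> t /BV/VU.
have oV : open V by exact: ball_open.
pose W := [set q : F * F | V q.1] `&` trans_dom phi.
have oW : open W.
  apply: openI => //; apply: open_comp oV => q _; exact: cvg_fst.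
have Wp : W p by split => //; exact: ballxx.
have [E' HE'] : exists E', equivalence_groupoid r (E, E', restrict_trans phi W).
  apply: (form_target (psi1 := psi1) (psi2 := psi2) (X0 := X0) (V := V) (sigma := sigma)) => //.
  - by move=> t /VU'/UE.
  - by split=> [|t /VU'/L1]; first exact: (smooth_on_sub VU' s1).
  - by split=> [|t /VU'/L2]; first exact: (smooth_on_sub VU' s2).
  - exact: (smooth_on_sub VU' sX0).
  - by move=> t /VU'/nz[].
  - by move=> t /VU'/nz[].
  - by exists p.
  - by move=> q [].
  - by move=> q [_ Dq]; exact: Ephi.
by exists W, E'; split => // q [].
Qed.

(** With no terms of order 0 and 1, the homogeneous equation is solved by 1 and t; taken as psi1 and
    psi2 they show that every equation of the class occurs as a source. *)
Lemma identity_A2_form (F : numFieldType) (r : nat) (E : arnold2_ode F) :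
  (2 <= r)%N -> class_A2 r E ->
  A2_form r E (Transformation [set q : F * F | ode_dom E q.1] fst snd).
Proof.
move=> r2 [oE [t0 Et0] _ _].
have EU : [set q.1 | q in [set q : F * F | ode_dom E q.1]] = ode_dom E.
  by apply/seteqP; split=> [_ [q Eq <-] //|t Et]; exists (t, 0).
have d1 k : (0 < k)%N -> derive1n k (fun=> 1 : F) = fun=> 0.
  elim: k => [//|[|k] IH] _; apply/funext => t; first by rewrite /= derive1E derive_cst.
  by rewrite -[LHS]/(derive1 (derive1n k.+1 (fun=> 1 : F)) t) IH // derive1E derive_cst.
have did k : (1 < k)%N -> derive1n k (id : F -> F) = fun=> 0.
  case: k => [//|k] k0; rewrite /derive1n iterSr.
  rewrite (_ : derive1 (id : F -> F) = fun=> 1); first exact: d1.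
  by apply/funext => t; rewrite derive1E derive_id.
have locus f : (forall k, (1 < k)%N -> derive1n k f = fun=> 0) ->
    forall t, ode_dom E t -> ode_locus (homogeneous E) (jet r f t).
  move=> f0 t Et; split; rewrite /= ?jet_t_jet // jet_x_jet // f0 // add0r.
  apply: big1_seq => i; rewrite mem_index_iota /= => /andP[i2 ir].
  by rewrite jet_x_jet ?f0 ?mulr0 // ltnW.
rewrite /A2_form /trans_dom EU; split => //.
- by apply: open_comp oE => q _; exact: cvg_fst.
- by exists (t0, 0).
exists (fun=> 1), id, (fun=> 0); split.
- split; split; [exact: smooth_on_cst | by apply: locus => k /ltnW; exact: d1 | |].
    move=> n; apply: (@class_C_aff _ _ _ _ _ id) => [p|v p]; first exact: ex_diff.
    by rewrite deriveE ?diff_val.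
  by apply: locus => k; exact: did.
- exact: lin_indep_on_1t oE Et0.
- move=> t _; split; first exact: oner_neq0.
  rewrite (_ : (fun s : F => _) = id).
    by rewrite derive1E derive_id oner_neq0.
  by apply/funext => s; rewrite divr1.
- exact: smooth_on_cst.
- by move=> q _; rewrite /= !divr1 addr0.
Qed.

Theorem proposition21 (F : numFieldType) (HF : real_or_complex F)
    (r : nat) (hr : (3 <= r)%N) :
  [/\ (* every admissible transformation is locally of the indicated form *)
      forall (E E' : arnold2_ode F) (phi : transformation F),
        equivalence_groupoid r (E, E', phi) ->
        forall p, trans_dom phi p ->
        exists W, [/\ open_nbhs p W, W `<=` trans_dom phi &
                      A2_form r E (restrict_trans phi W)],
      (* every transformation of this form is locally admissible *)
      forall (E : arnold2_ode F) (phi : transformation F),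
        class_A2 r E -> A2_form r E phi ->
        forall p, trans_dom phi p ->
        exists W E', [/\ open_nbhs p W, W `<=` trans_dom phi &
                         equivalence_groupoid r (E, E', restrict_trans phi W)]
    & (* the equation-sources exhaust the class *)
      forall E : arnold2_ode F, class_A2 r E ->
        forall p : F * F, ode_dom E p.1 ->
        exists E' phi, equivalence_groupoid r (E, E', phi) /\ trans_dom phi p].
Proof.
have r2 : (2 <= r)%N := ltnW hr.
split=> [E E' phi|E phi clE form p Dp|E clE p Ep].
- case: r hr {r2} => [|[|[|s]]] // _ [/= _ _ Hphi Hmap] p Dp.
  exact: (admissible_A2_form HF Hphi Hmap Dp).
- exact: A2_form_admissible.
- have [W [E' [[_ Wp] _ HE']]] := A2_form_admissible HF (p := p) r2 clE
    (identity_A2_form r2 clE) Ep.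
  by exists E', (restrict_trans (Transformation [set q | ode_dom E q.1] fst snd) W).
Qed.
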